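(* Let $(p_n)_{n\ge1}$ be a sequence of positive real numbers with $p_n\to0$ and $\sum_{n=1}^{\infty}p_n=+\infty$. Let $(R_n)_{n\ge1}$ be a sequence of $2\times2$ matrices with $\sum_{n=1}^\infty\|R_n\|<\infty$. Let $(V_n)_{n\ge1}$ be a sequence of real $2\times2$ matrices with $\sum_{n=1}^{\infty}\|V_{n+1}-V_n\|<\infty$, and suppose that $V:=\lim_{n\to\infty}V_n$ satisfies $\operatorname{discr}V\neq0$ (i.e. $V$ has two different eigenvalues). Suppose that $\det(I+p_nV_n+R_n)\neq0$ for every $n\ge1$. Then the linear difference system in $\mathbb{C}^2$ $$\begin{pmatrix}u_{n+1}\\ v_{n+1}\end{pmatrix}=(I+p_nV_n+R_n)\begin{pmatrix}u_n\\ v_n\end{pmatrix},\qquad n\ge1,$$ has a basis of solutions $\overrightarrow{u}^{(1)}_n$ and $\overrightarrow{u}^{(2)}_n$ with the following asymptotics as $n\to\infty$: $$\overrightarrow{u}^{(i)}_n=\left(\prod_{k=1}^{n}[1+p_k\mu_i(k)]\right)(\overrightarrow{x}_i+o(1)),\qquad i=1,2,$$ where $\mu_1,\mu_2$ (with $\operatorname{Re}\mu_1\le\operatorname{Re}\mu_2$) are the eigenvalues of $V$, $\overrightarrow{x}_1,\overrightarrow{x}_2$ are corresponding eigenvectors of $V$, and $\mu_1(n),\mu_2(n)$ are the eigenvalues of $V_n$, labelled in such a way that $\mu_1(n)\to\mu_1$ and $\mu_2(n)\to\mu_2$ as $n\to\infty$.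
   Context: For a $2\times2$ matrix $A$, $\operatorname{discr}A:=(\operatorname{tr}A)^2-4\det A$. $I$ is the $2\times2$ identity matrix. Convention on products: in products of scalar sequences, zero factors are omitted, i.e. $\prod_{k=1}^{n}c_k$ means the product over those $k\in\{1,\dots,n\}$ with $c_k\neq0$. *)

(* Defs.v *)
(* MathComp-Analysis, with R[i] from mathcomp-real-closed. *)
From HB Require Import structures.
From mathcomp Require Export all_boot all_order all_algebra.
From mathcomp Require Export complex.
From mathcomp Require Export all_classical all_reals all_analysis.
Export numFieldNormedType.Exports.
Export Order.TTheory GRing.Theory Num.Theory.

Set Implicit Arguments.
Unset Strict Implicit.
Unset Printing Implicit Defensive.

Local Open Scope classical_set_scope.
Local Open Scope ring_scope.
Local Open Scope complex_scope.

(* R[i] packaged as a numClosedFieldType: the topology and the norm that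
   MathComp-Analysis attaches to an arbitrary numFieldType (and to matrices over
   it) are then inferred, which does not happen for the bare type R[i]. *)
Definition CC (R : realType) : numClosedFieldType := R[i].

Definition RtoC (R : realType) (x : R) : CC R := x%:C.

Definition mxRtoC (R : realType) (m n : nat) (A : 'M[R]_(m, n)) :
    'M[CC R]_(m, n) :=
  map_mx (@RtoC R) A.

(* The library norm of a complex matrix (maximum of the moduli of the entries)
   takes its values in CC R, where it is real and nonnegative. *)
Definition mxnormC (R : realType) (A : 'M[CC R]_2) : R := complex.Re `|A|.

Definition discr (K : comNzRingType) (A : 'M[K]_2) : K :=
  (\tr A) ^+ 2 - 4%:R * \det A.

(* a and b are the two eigenvalues of A, counted with algebraic multiplicity *)
Definition eigenvalue_pair (K : comNzRingType) (A : 'M[K]_2) (a b : K) : Prop :=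
  char_poly A = ('X - a%:P) * ('X - b%:P).

(* Column eigenvectors; the library's eigenspace consists of row vectors. *)
Definition eigenvector (K : fieldType) (A : 'M[K]_2) (a : K) (x : 'cV[K]_2) :
    Prop :=
  x != 0 /\ A *m x = a *: x.

(* Sequences are indexed from 1; their value at 0 is irrelevant throughout. *)
Definition eigenvalue_labelling (R : realType) (V_ : nat -> 'M[R]_2)
    (mu1 mu2 : CC R) (mu1_ mu2_ : nat -> CC R) : Prop :=
  [/\ forall n, (1 <= n)%N -> eigenvalue_pair (mxRtoC (V_ n)) (mu1_ n) (mu2_ n),
      mu1_ @ \oo --> mu1
    & mu2_ @ \oo --> mu2].

Definition solution (K : fieldType) (A : nat -> 'M[K]_2) (u : nat -> 'cV[K]_2) :
    Prop :=
  forall n, (1 <= n)%N -> u n.+1 = A n *m u n.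

Definition solution_basis (K : fieldType) (A : nat -> 'M[K]_2)
    (u1 u2 : nat -> 'cV[K]_2) : Prop :=
  [/\ solution A u1,
      solution A u2,
      forall a b : K,
        (forall n, (1 <= n)%N -> a *: u1 n + b *: u2 n = 0) -> a = 0 /\ b = 0
    & forall w, solution A w -> exists a b : K,
        forall n, (1 <= n)%N -> w n = a *: u1 n + b *: u2 n].

(* c_1 ... c_n, with the zero factors omitted *)
Definition nzprod (K : comNzRingType) (c : nat -> K) (n : nat) : K :=
  \prod_(1 <= k < n.+1 | c k != 0) c k.

(* u_n = c_n (x + o(1)) as n -> oo *)
Definition asymptotics (R : realType) (u : nat -> 'cV[CC R]_2) (c : nat -> CC R)
    (x : 'cV[CC R]_2) : Prop :=
  exists e : nat -> 'cV[CC R]_2,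
    e @ \oo --> (0 : 'cV[CC R]_2) /\
    forall n, (1 <= n)%N -> u n = c n *: (x + e n).

(* Main.v *)
From HB Require Import structures.
Require Import Defs.
From mathcomp Require Import ring lra.

(** The system is diagonalised in a moving frame, and the diagonal system with
    summable errors that results is solved by hand.

    The frame. By Cayley-Hamilton [F n = (V_n - mu2(n)) x1] and
    [G n = (V_n - mu1(n)) x2] are eigenvectors of [V_n] for [mu1(n)] and [mu2(n)],
    and they tend to nonzero multiples of [x1] and [x2]. The increments of [V_n]
    are summable, hence so are those of its eigenvalues
    ([summable_increments_eigenvalue]: the limits are distinct, so the
    characteristic equation can be divided by the distance to the other root) and
    those of the frame. For [u = x F + y G] the system becomes
    [x+ = (al + a) x + b y], [y+ = c x + (be + d) y] with
    [al = 1 + p mu1(n)], [be = 1 + p mu2(n)] and absolutely summable [a, b, c, d]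
    ([reduction_to_planar]).

    Dichotomy. The matrices [V_n] are real and [discr V] is a nonzero real. If it is
    negative, the eigenvalues of [V_n] are eventually conjugate and
    [|al| = |be|]. If it is positive, they are eventually real and separated, so
    that [|al| <= (1 - h) |be|] with [h] a multiple of [p], and the quotient of the
    products [P] of [al] and [Q] of [be] tends to zero, as [p] is not summable.

    The planar system. If [|al| <= |be|], the solution that starts at [(0, 1)],
    late enough for the remaining errors to be small, grows like [Q]
    ([growing_solution]). Reduction of order with the Casoratian of two solutions
    then produces a solution asymptotic to [P (1, 0)] ([subdominant_solution]). In
    the conjugate case this applies with either coordinate in the first place, and
    gives both members of the basis. In the real case the second one is the growing
    solution itself, whose first coordinate is small compared to [Q] because
    [P / Q] tends to zero ([dominant_solution]).

    The factors [1 + p_k mu_i(k)] that vanish are finitely many, since [p] tends to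
    zero, and the first ones only change a constant; the solutions found late are
    extended back to time [1] because every step is invertible. *)

Set Implicit Arguments.
Unset Strict Implicit.
Unset Printing Implicit Defensive.

Local Open Scope classical_set_scope.
Local Open Scope ring_scope.

(** * Real modulus and convergence of complex sequences *)

HB.instance Definition _ (R : realType) :=
  GRing.RMorphism.copy (@RtoC R) (@real_complex_def R (Phant R)).

Section Modulus.
Variable R : realType.
Implicit Types z w : CC R.

(** The norm of a complex number is itself complex valued; real estimates and
    real limits need its real part. *)
Definition cmod z : R := complex.Re `|z|.

Lemma normrC_cmod z : `|z| = RtoC (cmod z).
Proof. by []. Qed.

Lemma ler_RtoC (x y : R) : (RtoC x <= RtoC y) = (x <= y).
Proof. exact: lecR. Qed.

Lemma ltr_RtoC (x y : R) : (RtoC x < RtoC y) = (x < y).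
Proof. exact: ltcR. Qed.

Lemma RtoC_inj : injective (@RtoC R).
Proof. by move=> x y []. Qed.

Lemma cmod_ge0 z : 0 <= cmod z.
Proof. by rewrite -ler_RtoC -normrC_cmod rmorph0. Qed.

Lemma cmodM z w : cmod (z * w) = cmod z * cmod w.
Proof. by apply: RtoC_inj; rewrite rmorphM -!normrC_cmod normrM. Qed.

Lemma cmodV z : cmod z^-1 = (cmod z)^-1.
Proof. by apply: RtoC_inj; rewrite fmorphV -!normrC_cmod normfV. Qed.

Lemma cmod0 : cmod 0 = 0.
Proof. by rewrite /cmod normr0. Qed.

Lemma cmod1 : cmod 1 = 1.
Proof. by rewrite /cmod normr1. Qed.

Lemma cmodN z : cmod (- z) = cmod z.
Proof. by rewrite /cmod normrN. Qed.

Lemma cmod_distC z w : cmod (z - w) = cmod (w - z).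
Proof. by rewrite /cmod distrC. Qed.

Lemma ler_cmodD z w : cmod (z + w) <= cmod z + cmod w.
Proof. by rewrite -ler_RtoC rmorphD -!normrC_cmod ler_normD. Qed.

Lemma cmod_eq0 z : (cmod z == 0) = (z == 0).
Proof.
by rewrite -[LHS](inj_eq RtoC_inj) -normrC_cmod rmorph0 normr_eq0.
Qed.

Lemma cmod_gt0 z : (0 < cmod z) = (z != 0).
Proof. by rewrite lt0r cmod_ge0 andbT cmod_eq0. Qed.

Lemma cmod_RtoC (x : R) : cmod (RtoC x) = `|x|.
Proof. by rewrite /cmod normc_def /= expr0n addr0 sqrtr_sqr. Qed.

Lemma cmodE z : cmod z ^+ 2 = complex.Re z ^+ 2 + complex.Im z ^+ 2.
Proof. by rewrite /cmod normc_def sqr_sqrtr // addr_ge0 ?sqr_ge0. Qed.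

Lemma ler_Re_cmod z : `|complex.Re z| <= cmod z.
Proof.
rewrite -(@ler_pXn2r _ 2) ?nnegrE ?cmod_ge0 // cmodE real_normK ?num_real //.
by rewrite lerDl sqr_ge0.
Qed.

Lemma ler_Im_cmod z : `|complex.Im z| <= cmod z.
Proof.
rewrite -(@ler_pXn2r _ 2) ?nnegrE ?cmod_ge0 // cmodE real_normK ?num_real //.
by rewrite lerDr sqr_ge0.
Qed.

Lemma cmod_le_ReIm z : cmod z <= `|complex.Re z| + `|complex.Im z|.
Proof.
rewrite -(@ler_pXn2r _ 2) ?nnegrE ?cmod_ge0 ?addr_ge0 // cmodE.
rewrite sqrrD !real_normK ?num_real //.
by have := mulr_ge0 (normr_ge0 (complex.Re z)) (normr_ge0 (complex.Im z)); lra.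
Qed.

Lemma ltC_RtoC (e : CC R) : 0 < e -> exists2 x : R, 0 < x & e = RtoC x.
Proof.
case: e => a b; rewrite ltcE /= => /andP[/eqP ->  a0].
by exists a.
Qed.

(** A positive element of the complex field is a positive real, so the
    neighbourhoods given by the complex-valued norm are those of the modulus. *)
Lemma cvg_cmodP (f : nat -> CC R) (l : CC R) :
  (f @ \oo --> l) <-> ((fun n => cmod (f n - l)) @ \oo --> (0 : R)).
Proof.
split=> [/cvgrPdist_lt fl | fl].
- apply/cvgr0Pnorm_lt => e e0.
  have e0' : 0 < RtoC e by rewrite -(rmorph0 (@RtoC R)) ltr_RtoC.
  move: (fl _ e0'); apply: filterS => n /=.
  by rewrite normrC_cmod ltr_RtoC cmod_distC ger0_norm ?cmod_ge0.
- apply/cvgrPdist_lt => e /ltC_RtoC[x x0 ->].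
  move/cvgr0Pnorm_lt: fl => /(_ _ x0); apply: filterS => n /=.
  by rewrite normrC_cmod ltr_RtoC cmod_distC ger0_norm ?cmod_ge0.
Qed.

Lemma cvg_cmod_le (f : nat -> CC R) (l : CC R) (e : nat -> R) :
  (\forall n \near \oo, cmod (f n - l) <= e n) -> e @ \oo --> 0 -> f @ \oo --> l.
Proof.
move=> fe e0; apply/cvg_cmodP.
apply: (squeeze_cvgr _ (cvg_cst (0:R)) e0); move: fe.
by apply: filterS => n ->; rewrite cmod_ge0.
Qed.

Lemma cvg_cmod (f : nat -> CC R) (l : CC R) :
  f @ \oo --> l -> (fun n => cmod (f n)) @ \oo --> cmod l.
Proof.
move=> /cvg_cmodP fl.
apply/subr_cvg0.
apply/cvgr0Pnorm_lt => e e0.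
move/cvgr0Pnorm_lt : fl => /(_ _ e0); apply: filterS => n /=; apply: le_lt_trans.
rewrite (ger0_norm (cmod_ge0 _)) ler_norml.
have := ler_cmodD (f n - l) l; rewrite subrK => h1.
have := ler_cmodD (l - f n) (f n); rewrite subrK cmod_distC => h2.
by apply/andP; split; lra.
Qed.

(** Completeness is inherited from the real and imaginary parts, and the rate
    passes to the limit because the modulus is continuous. *)
Lemma cauchy_rate (f : nat -> CC R) (e : nat -> R) :
  (forall n m, (n <= m)%N -> cmod (f m - f n) <= e n) -> e @ \oo --> 0 ->
  exists2 l, f @ \oo --> l & forall n, cmod (f n - l) <= e n.
Proof.
move=> fe e0.
have part (g : nat -> R) :
    (forall n m, (n <= m)%N -> `|g m - g n| <= e n) -> cvgn g.
  move=> ge; apply/cauchy_cvgP; apply: cauchy_exP => d d0.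
  move/cvgr0Pnorm_lt : e0 => /(_ _ d0) [N _ HN].
  exists (g N); exists N => // n /= Nn.
  rewrite -ball_normE /= distrC; apply: le_lt_trans (ge _ _ Nn) _.
  by apply: le_lt_trans (ler_norm _) _; apply: HN => /=.
have cRe : cvgn (fun n => complex.Re (f n)).
  apply: part => n m nm; apply: le_trans (fe n m nm).
  by have := ler_Re_cmod (f m - f n); rewrite (raddfB (@complex.Re R)).
have cIm : cvgn (fun n => complex.Im (f n)).
  apply: part => n m nm; apply: le_trans (fe n m nm).
  by have := ler_Im_cmod (f m - f n); rewrite (raddfB (@complex.Im R)).
pose l : CC R := Complex (limn (fun n => complex.Re (f n)))
    (limn (fun n => complex.Im (f n))).
have fl : f @ \oo --> l.
  apply: (@cvg_cmod_le _ _ (fun n => `|complex.Re (f n) - complex.Re l|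
    + `|complex.Im (f n) - complex.Im l|)).
    apply: nearW => n; apply: le_trans (cmod_le_ReIm _) _.
    by rewrite (raddfB (@complex.Re R)) (raddfB (@complex.Im R)).
  rewrite -(addr0 0); apply: cvgD.
    by apply/norm_cvg0P; rewrite -(subrr (complex.Re l)); apply: cvgB => //;
      apply: cvg_cst.
  by apply/norm_cvg0P; rewrite -(subrr (complex.Im l)); apply: cvgB => //;
    apply: cvg_cst.
exists l => // n.
have h : (fun m => cmod (f m - f n)) @ \oo --> cmod (l - f n).
  by apply: cvg_cmod; exact: (cvgB fl (cvg_cst (f n))).
rewrite cmod_distC -(cvg_lim _ h) //.
apply: limr_le; first by apply/cvg_ex; exists (cmod (l - f n)).
by exists n => // m /=; exact: fe.
Qed.
End Modulus.

(** * Real series and recursive inequalities *)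

Section Summability.
Variable R : realType.
Implicit Types (t g : nat -> R) (f : nat -> CC R).

Definition series_tail t (n : nat) : R := limn (series t) - series t n.

Lemma series_tail_cvg0 t : cvgn (series t) -> series_tail t @ \oo --> (0 : R).
Proof.
move=> ct; rewrite -(subrr (limn (series t))).
by apply: cvgB ct; exact: cvg_cst.
Qed.

Lemma series_le_tail t n m : (forall k, 0 <= t k) -> cvgn (series t) ->
  series t m - series t n <= series_tail t n.
Proof.
move=> t0 ct; rewrite lerD2r.
apply: nondecreasing_cvgn_le ct m.
by apply/nondecreasing_seqP => k; rewrite seriesSr lerDl.
Qed.

Lemma series_shift t N n :
  series (fun k => t (N + k)%N) n = series t (N + n)%N - series t N.
Proof.
elim: n => [|n IH]; first by rewrite addn0 subrr [LHS]big_geq.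
by rewrite addnS !seriesSr IH addrAC.
Qed.

Lemma series_tail_ge0 t n : (forall k, 0 <= t k) -> cvgn (series t) ->
    0 <= series_tail t n.
Proof. by move=> t0 ct; rewrite -(subrr (series t n)) series_le_tail. Qed.

Lemma series_tail0_le t M : (forall n, series t n <= M) -> cvgn (series t) ->
    series_tail t 0 <= M.
Proof.
move=> tM ct; rewrite /series_tail [series t 0]big_geq // subr0.
by apply: limr_le => //; apply: nearW.
Qed.

Lemma bounded_series_cvg t M : (forall k, 0 <= t k) ->
  (forall n, series t n <= M) -> cvgn (series t).
Proof.
move=> t0 tM; apply: nondecreasing_is_cvgn.
  by apply/nondecreasing_seqP => k; rewrite seriesSr lerDl.
by exists M => _ [n _ <-].
Qed.

(** The decreasing weight [g] can be taken out of the tail sums, and so remains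
    in front of the rate. The reduction of order below needs it: there [g n] is
    a multiple of [|P_n / Q_n|], and the rate has to be small compared to it. *)
Lemma summable_steps f t g : (forall n, 0 <= t n) -> cvgn (series t) ->
  (forall n, 0 <= g n) -> (forall n, g n.+1 <= g n) ->
  (forall n, cmod (f n.+1 - f n) <= g n * t n) ->
  exists2 l, f @ \oo --> l & forall n, cmod (f n - l) <= g n * series_tail t n.
Proof.
move=> t0 ct g0 gd fg.
have gm n k : g (n + k)%N <= g n.
  by elim: k => [|k IH]; rewrite ?addn0 // addnS (le_trans (gd _)).
have h n k : cmod (f (n + k)%N - f n) <= g n * (series t (n + k)%N - series t n).
  elim: k => [|k IH]; first by rewrite addn0 !subrr cmod0 mulr0.
  rewrite addnS seriesSr.
  have -> : f (n + k).+1 - f n = (f (n + k).+1 - f (n + k)%N) + (f (n + k)%N - f n)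
      by ring.
  apply: le_trans (ler_cmodD _ _) _.
  have := fg (n + k)%N; have := ler_wpM2r (t0 (n + k)%N) (gm n k); lra.
apply: cauchy_rate => [n m nm|].
  rewrite -(subnKC nm); apply: le_trans (h _ _) _.
  by apply: ler_wpM2l => //; exact: series_le_tail.
apply: (squeeze_cvgr _ (cvg_cst (0 : R))); last first.
  rewrite -(mulr0 (g 0%N)); apply: cvgM;
    [exact: cvg_cst|exact: (series_tail_cvg0 ct)].
apply: nearW => n /=; rewrite mulr_ge0 ?series_tail_ge0 //=.
by apply: ler_wpM2r; rewrite ?series_tail_ge0 // -[n]add0n.
Qed.

(** With [S n] the partial sums of [t], the quantity [(1 - S n) * m n] does not
    increase, because [(1 - S - t) * (1 + t) <= 1 - S]. *)
Lemma discrete_gronwall (m t : nat -> R) : (forall n, 0 <= m n) ->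
  (forall n, 0 <= t n) -> (forall n, series t n <= 2^-1) ->
  (forall n, m n.+1 <= (1 + t n) * m n) -> forall n, m n <= 2 * m 0%N.
Proof.
move=> m0 t0 t2 mS n.
suff : (1 - series t n) * m n <= m 0%N.
  have := ler_wpM2r (m0 n) (_ : 2^-1 <= 1 - series t n).
  have -> : 2^-1 <= 1 - series t n by have := t2 n; lra.
  by move=> /(_ isT); lra.
elim: n => [|n IH]; first by rewrite [series t 0]big_geq // subr0 mul1r.
apply: le_trans IH; have := t2 n.+1; rewrite seriesSr => h.
have s0 : 0 <= series t n by apply: sumr_ge0.
have := t0 n; move: (series t n) (t n) (m n) (m n.+1) (mS n) (m0 n) s0 h =>
    s u a b hb a0 s0 h u0.
apply: (@le_trans _ _ ((1 - (s + u)) * ((1 + u) * a))).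
  by apply: ler_wpM2l => //; lra.
have := mulr_ge0 a0 (mulr_ge0 s0 u0); have := mulr_ge0 a0 (mulr_ge0 u0 u0); lra.
Qed.

(** The factors [r n.+1 / r n] multiply to zero, so the state reached at a time
    [n] is eventually forgotten; what comes later is at most the tail of [t] at
    [n], which is small. *)
Lemma contraction_cvg0 (z r t : nat -> R) : (forall n, 0 <= z n) ->
  (forall n, 0 < r n) -> (forall n, r n.+1 <= r n) -> r @ \oo --> (0 : R) ->
  (forall n, 0 <= t n) -> cvgn (series t) ->
  (forall n, z n.+1 <= r n.+1 / r n * z n + t n) -> z @ \oo --> (0 : R).
Proof.
move=> z0 r0 rd rc t0 ct zS.
have h n k : z (n + k)%N <= r (n + k)%N / r n * z n
    + (series t (n + k)%N - series t n).
  elim: k => [|k IH].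
    by rewrite addn0 subrr addr0 divff ?mul1r // gt_eqF.
  rewrite addnS seriesSr; apply: le_trans (zS _) _.
  have q0 : 0 <= r (n + k).+1 / r (n + k)%N by rewrite divr_ge0 // ltW.
  have q1 : r (n + k).+1 / r (n + k)%N <= 1 by rewrite ler_pdivrMr // mul1r.
  have := ler_wpM2l q0 IH.
  have -> : r (n + k).+1 / r (n + k)%N * (r (n + k)%N / r n * z n
      + (series t (n + k)%N - series t n))
     = r (n + k).+1 / r n * z n
         + r (n + k).+1 / r (n + k)%N * (series t (n + k)%N - series t n).
    by field; rewrite !gt_eqF.
  have s0 : 0 <= series t (n + k)%N - series t n.
    by rewrite subr_ge0; apply/(@nondecreasing_series _ _ xpredT);
      rewrite ?leq_addr.
  by have := ler_wpM2r s0 q1; lra.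
apply/cvgr0Pnorm_lt => e e0.
have e20 : 0 < e / 2 by rewrite divr_gt0.
have /cvgr0Pnorm_lt/(_ _ e20)[n _ Hn] := series_tail_cvg0 ct.
have d0 : 0 < e / 2 / ((z n + 1) / r n).
  by rewrite divr_gt0 // divr_gt0 // ltr_wpDl.
have /cvgr0Pnorm_lt/(_ _ d0)[m _ Hm] := rc.
exists (maxn n m) => // k /=; rewrite geq_max => /andP[nk mk].
rewrite ger0_norm //; have := h n (k - n)%N; rewrite subnKC // => hk.
have := Hn n (leqnn n); rewrite /= ger0_norm ?series_tail_ge0 // => h1.
have := @series_le_tail t n k t0 ct => h2.
have := Hm k mk; rewrite /= ger0_norm ?ltW // ltr_pdivlMr; last first.
  by rewrite divr_gt0 // ltr_wpDl.
move=> h3.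
have : r k / r n * z n <= r k * ((z n + 1) / r n).
  have -> : r k / r n * z n = r k * (z n / r n) by ring.
  by rewrite ler_pM2l // ler_pM2r ?invr_gt0 // lerDl.
by move=> h4; lra.
Qed.

End Summability.

(** * Perturbed diagonal systems in the plane *)

(** The diagonal system with entries [al], [be], perturbed by the matrix with
    rows [(a, b)] and [(c, d)]. *)
Definition planar_system (K : nzRingType) (al be a b c d x y : nat -> K) : Prop :=
  forall n, x n.+1 = (al n + a n) * x n + b n * y n /\
            y n.+1 = c n * x n + (be n + d n) * y n.

Lemma planar_system_exists (K : nzRingType) (al be a b c d : nat -> K) (x0 y0 : K) :
  exists x y, [/\ planar_system al be a b c d x y, x 0%N = x0 & y 0%N = y0].
Proof.
pose step n (q : K * K) :=
  ((al n + a n) * q.1 + b n * q.2, c n * q.1 + (be n + d n) * q.2).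
pose q := fix q n := if n is m.+1 then step m (q m) else (x0, y0).
by exists (fun n => (q n).1), (fun n => (q n).2).
Qed.

Lemma planar_system_subZ (K : comNzRingType) (al be a b c d x y x' y' : nat -> K)
    (k : K) :
  planar_system al be a b c d x y -> planar_system al be a b c d x' y' ->
  planar_system al be a b c d (fun n => x' n - k * x n) (fun n => y' n - k * y n).
Proof.
by move=> s s' n; have [-> ->] := s n; have [-> ->] := s' n; split; ring.
Qed.

Lemma planar_systemZ (K : comNzRingType) (al be a b c d x y : nat -> K) (k : K) :
  planar_system al be a b c d x y ->
  planar_system al be a b c d (fun n => k * x n) (fun n => k * y n).
Proof. by move=> s n; have [-> ->] := s n; split; ring. Qed.

Section Core.
Variables (R : realType) (al be a b c d : nat -> CC R) (t : nat -> R).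
Hypotheses (al0 : forall n, al n != 0) (be0 : forall n, be n != 0).
Hypothesis albe : forall n, cmod (al n) <= cmod (be n).
Hypothesis t0 : forall n, 0 <= t n.
Hypothesis t_small : forall n, series t n <= 16^-1.
Hypothesis small : forall n,
  [/\ cmod (a n) <= t n * cmod (al n), cmod (b n) <= t n * cmod (al n),
      cmod (c n) <= t n * cmod (al n) & cmod (d n) <= t n * cmod (al n)].

Let P n := \prod_(k < n) al k.
Let Q n := \prod_(k < n) be k.
Let sys := planar_system al be a b c d.

Let PS n : P n.+1 = P n * al n. Proof. exact: big_ord_recr. Qed.
Let QS n : Q n.+1 = Q n * be n. Proof. exact: big_ord_recr. Qed.
Let P0 n : P n != 0. Proof. by apply/prodf_neq0 => i _. Qed.
Let Q0 n : Q n != 0. Proof. by apply/prodf_neq0 => i _. Qed.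

Let t_cvg : cvgn (series t). Proof. exact: bounded_series_cvg t_small. Qed.

Let t_le n : t n <= 16^-1.
Proof.
have := t_small n.+1; rewrite seriesSr.
have : 0 <= series t n by apply: sumr_ge0.
by move=> *; lra.
Qed.

Let ratio n := cmod (P n / Q n).

Let ratio_gt0 n : 0 < ratio n.
Proof. by rewrite cmod_gt0 mulf_neq0 ?invr_eq0. Qed.

Let ratioS n : ratio n.+1 = ratio n * (cmod (al n) / cmod (be n)).
Proof.
rewrite /ratio PS QS -cmodV -!cmodM; congr cmod.
by field; rewrite be0 Q0.
Qed.

Let quot_le1 n : cmod (al n) / cmod (be n) <= 1.
Proof. by rewrite ler_pdivrMr ?cmod_gt0 // mul1r. Qed.

Let ratio_dec n : ratio n.+1 <= ratio n.
Proof. by rewrite ratioS; apply: ler_piMr => //; exact: ltW. Qed.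

Let le_be n z : cmod z <= t n * cmod (al n) -> cmod (z / be n) <= t n.
Proof.
move=> h; rewrite cmodM cmodV ler_pdivrMr ?cmod_gt0 //.
by apply: le_trans h _; apply: ler_wpM2l.
Qed.

Let le_al n z : cmod z <= t n * cmod (al n) -> cmod (z / al n) <= t n.
Proof. by move=> h; rewrite cmodM cmodV ler_pdivrMr ?cmod_gt0. Qed.

(** Start from [(0, 1)] and divide by [Q]: the first coordinate is multiplied by
    [al / be], of modulus at most one, and both receive errors that are summable
    against the sum of the moduli. By Gronwall this sum stays below [2], so the
    second coordinate moves by at most [2 * 16^-1] in total: it converges, and
    it cannot approach zero. The first coordinate is a contraction with a
    summable forcing, and vanishes when the ratio [P / Q] does. *)
Lemma growing_solution : exists x y, [/\ sys x y, x 0%N = 0, y 0%N = 1 &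
  [/\ forall n, cmod (x n / Q n) <= 2, forall n, 2^-1 <= cmod (y n / Q n) <= 2,
    exists2 l, l != 0 & (fun n => y n / Q n) @ \oo --> l &
    ratio @ \oo --> (0 : R) -> (fun n => x n / Q n) @ \oo --> (0 : CC R)]].
Proof.
have [x [y [s x0 y0]]] := planar_system_exists al be a b c d 0 1.
exists x, y; split=> //.
pose xi n := x n / Q n; pose eta n := y n / Q n.
have xiS n : xi n.+1 = (al n / be n) * xi n
    + (a n / be n * xi n + b n / be n * eta n).
  by rewrite /xi /eta QS; have [-> _] := s n; field; rewrite be0 Q0.
have etaS n : eta n.+1 - eta n = c n / be n * xi n + d n / be n * eta n.
  by rewrite /xi /eta QS; have [_ ->] := s n; field; rewrite be0 Q0.
have err n u v : cmod u <= t n -> cmod v <= t n ->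
    cmod (u * xi n + v * eta n) <= t n * (cmod (xi n) + cmod (eta n)).
  move=> ut vt; apply: le_trans (ler_cmodD _ _) _;
    rewrite (cmodM u) (cmodM v) mulrDr.
  exact: lerD (ler_wpM2r (cmod_ge0 _) ut) (ler_wpM2r (cmod_ge0 _) vt).
have xiS_le n : cmod (xi n.+1) <= cmod (al n) / cmod (be n) * cmod (xi n)
    + t n * (cmod (xi n) + cmod (eta n)).
  rewrite xiS; apply: le_trans (ler_cmodD _ _) _.
  rewrite (cmodM (al n / be n)) (cmodM (al n)) cmodV lerD2l.
  have [ha hb _ _] := small n.
  by apply: err; exact: le_be.
have etaS_le n : cmod (eta n.+1 - eta n) <= t n * (cmod (xi n) + cmod (eta n)).
  by rewrite etaS; have [_ _ hc hd] := small n; apply: err; exact: le_be.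
pose m n := cmod (xi n) + cmod (eta n).
have m_le n : m n <= 2.
  have -> : 2 = 2 * m 0%N :> R.
    by rewrite /m /xi /eta x0 y0 /Q big_ord0 !divr1 cmod0 cmod1 add0r mulr1.
  have Et k : series (fun n => 2 * t n) k = 2 * series t k.
    by rewrite /series /= mulr_sumr.
  apply: (@discrete_gronwall _ m (fun n => 2 * t n)) => k.
  - by rewrite addr_ge0 ?cmod_ge0.
  - by rewrite mulr_ge0.
  - by rewrite Et; have := t_small k; lra.
  have h1 := ler_cmodD (eta k.+1 - eta k) (eta k); rewrite subrK in h1.
  have := xiS_le k; have := etaS_le k.
  have := ler_wpM2r (cmod_ge0 (xi k)) (quot_le1 k).
  by rewrite /m; lra.
have [l etal ratel] : exists2 l, eta @ \oo --> l &
    forall n, cmod (eta n - l) <= 2 * series_tail t n.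
  apply: (@summable_steps _ eta t (fun=> 2)) => // n.
  apply: le_trans (etaS_le n) _; rewrite mulrC; apply: ler_wpM2r => //; exact: m_le.
have tail16 n : series_tail t n <= 16^-1.
  apply: le_trans (series_tail0_le t_small t_cvg).
  rewrite lerD2l lerN2; apply: (@nondecreasing_series _ t xpredT) => //.
have eta0 : eta 0%N = 1 by rewrite /eta y0 /Q big_ord0 divr1.
have dl : cmod (1 - l) <= 8^-1.
  by have := ratel 0%N; rewrite eta0; have := tail16 0%N; lra.
split.
- by move=> n; have := m_le n; have := cmod_ge0 (eta n); rewrite /m /xi; lra.
- move=> n; rewrite -/(eta n); have := m_le n; have := cmod_ge0 (xi n).
  rewrite /m => h1 h2; apply/andP; split; last by lra.
  have h3 := ler_cmodD (l - eta n) (eta n); rewrite subrK in h3.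
  have h4 := ler_cmodD (1 - l) l; rewrite subrK cmod1 in h4.
  have := ratel n; have := tail16 n; rewrite cmod_distC => *; lra.
- exists l => //; apply/eqP => l0; move: dl; rewrite l0 subr0 cmod1; lra.
move=> rho0; apply: (@cvg_cmod_le _ _ _ (fun n => cmod (xi n))).
  by apply: nearW => n; rewrite subr0.
apply: (@contraction_cvg0 _ _ ratio (fun n => 2 * t n)) => //.
- by move=> n; exact: cmod_ge0.
- by move=> n; rewrite mulr_ge0.
- have -> : series (fun n => 2 * t n) = (fun n => 2 * series t n).
    by apply/funext => n; rewrite /series /= mulr_sumr.
  by apply: is_cvgM => //; exact: is_cvg_cst.
move=> n; apply: le_trans (xiS_le n) _.
have -> : ratio n.+1 / ratio n = cmod (al n) / cmod (be n).
  by rewrite ratioS mulrAC divff ?mul1r // gt_eqF.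
by rewrite lerD2l mulrC; apply: ler_wpM2r => //; exact: m_le.
Qed.

Lemma dominant_solution : ratio @ \oo --> (0 : R) -> exists x y, [/\ sys x y,
  (fun n => x n / Q n) @ \oo --> (0 : CC R) &
    (fun n => y n / Q n) @ \oo --> (1 : CC R)].
Proof.
move=> rho0; have [x [y [s _ _ [_ _ [l l0 yl] /(_ rho0) xl]]]] := growing_solution.
exists (fun n => l^-1 * x n), (fun n => l^-1 * y n); split.
- exact: planar_systemZ.
- have -> : (fun n => l^-1 * x n / Q n) = (fun n => l^-1 * (x n / Q n)).
    by apply/funext => n; rewrite mulrA.
  by rewrite -(mulr0 l^-1); exact: (cvgM (cvg_cst _) xl).
- have -> : (fun n => l^-1 * y n / Q n) = (fun n => l^-1 * (y n / Q n)).
    by apply/funext => n; rewrite mulrA.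
  by rewrite -(mulVf l0); exact: (cvgM (cvg_cst _) yl).
Qed.

(** Reduction of order. Let [(x, y)] be the growing solution, [(x', y')] the one
    that starts at [(1, 0)], and [W = x' y - x y'] their Casoratian, which is
    comparable to [P Q].
    The quotient [r = y' / y] has increments [c W / (y y+)], of size
    [t |P / Q|]; as [|P / Q|] decreases, [r] tends to some [r_] with an error that
    is small compared to [|P / Q|]. Hence [(x', y') - r_ (x, y)] has a second
    coordinate small compared to [P], and its Casoratian with [(x, y)], still
    [W], makes its first coordinate comparable to [P]. As equality
    [|al| = |be|] is admitted, the lemma applies to either coordinate when the
    moduli agree. *)
Lemma subdominant_solution : exists x y, [/\ sys x y,
  (fun n => x n / P n) @ \oo --> (1 : CC R) &
    (fun n => y n / P n) @ \oo --> (0 : CC R)].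
Proof.
have [x [y [s x0 y0 [xQ yQ [l l0 yl] _]]]] := growing_solution.
have [x' [y' [s' x'0 y'0]]] := planar_system_exists al be a b c d 1 0.
pose W n := x' n * y n - x n * y' n.
pose om n := W n / (P n * Q n).
pose eps n := a n / al n + d n / be n
    + (a n / al n * (d n / be n) - b n / al n * (c n / be n)).
(* [1 + eps n] is the determinant of the step divided by that of its diagonal
   part. *)
have omS n : om n.+1 = (1 + eps n) * om n.
  rewrite /om /W /eps PS QS; have [-> ->] := s n; have [-> ->] := s' n.
  by field; rewrite P0 Q0 al0 be0.
have eps_le n : cmod (eps n) <= 4 * t n.
  have [ha hb hc hd] := small n.
  apply: le_trans (ler_cmodD _ _) _.
  have := ler_cmodD (a n / al n) (d n / be n).
  have := ler_cmodD (a n / al n * (d n / be n)) (- (b n / al n * (c n / be n))).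
  rewrite cmodN (cmodM (a n / al n)) (cmodM (b n / al n)).
  have ta := le_al ha; have tb := le_al hb.
  have tc := le_be hc; have td := le_be hd.
  have := ler_pM (cmod_ge0 _) (cmod_ge0 _) ta td.
  have := ler_pM (cmod_ge0 _) (cmod_ge0 _) tb tc.
  have := ler_wpM2l (t0 n) (t_le n).
  have := t0 n.
  lra.
have om0 : om 0%N = 1.
  by rewrite /om /W /P /Q !big_ord0 x'0 y0 x0 mul0r subr0 !mulr1 divr1.
have om_le n : cmod (om n) <= 2.
  have -> : 2 = 2 * cmod (om 0%N) by rewrite om0 cmod1 mulr1.
  have Et k : series (fun n => 4 * t n) k = 4 * series t k.
    by rewrite /series /= mulr_sumr.
  apply: (@discrete_gronwall _ (fun n => cmod (om n)) (fun n => 4 * t n)) => k.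
  - exact: cmod_ge0.
  - by rewrite mulr_ge0.
  - by rewrite Et; have := t_small k; lra.
  rewrite omS cmodM; apply: ler_wpM2r; first exact: cmod_ge0.
  by apply: le_trans (ler_cmodD _ _) _; rewrite cmod1 lerD2l.
have [w oml ratew] : exists2 w, om @ \oo --> w &
    forall n, cmod (om n - w) <= 8 * series_tail t n.
  apply: (@summable_steps _ om t (fun=> 8)) => // n.
  have -> : om n.+1 - om n = eps n * om n by rewrite omS; ring.
  rewrite cmodM; have := ler_pM (cmod_ge0 _) (cmod_ge0 _) (eps_le n) (om_le n); lra.
have w0 : w != 0.
  apply/eqP => w0; have := ratew 0%N; rewrite w0 subr0 om0 cmod1.
  by have := series_tail0_le t_small t_cvg; lra.
have yn0 n : y n != 0.
  apply/eqP => y_0; have /andP[+ _] := yQ n; rewrite y_0 mul0r cmod0; lra.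
pose r n := y' n / y n.
have rS n : r n.+1 - r n =
    (c n / be n) * om n * (P n / Q n) / ((y n / Q n) * (y n.+1 / Q n.+1)).
  have -> : r n.+1 - r n = (y' n.+1 * y n - y n.+1 * y' n) / (y n * y n.+1).
    by rewrite /r; field; rewrite !yn0.
  have -> : y' n.+1 * y n - y n.+1 * y' n = c n * W n.
    by have [_ ->] := s n; have [_ ->] := s' n; rewrite /W; ring.
  by rewrite QS /om; field; rewrite P0 Q0 be0 !yn0.
have inv_le n : cmod (y n / Q n)^-1 <= 2.
  rewrite cmodV -[leRHS]invrK lef_pV2 ?posrE ?invr_gt0 ?cmod_gt0 ?mulf_neq0
    ?invr_eq0 //.
  by have /andP[] := yQ n.
have rS_le n : cmod (r n.+1 - r n) <= 8 * ratio n * t n.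
  rewrite rS invfM (cmodM (_ * _ * _)) (cmodM (_ * _)) (cmodM (c n / be n))
    (cmodM _^-1) -/(ratio n).
  have [_ _ hc _] := small n.
  have h1 := ler_pM (cmod_ge0 _) (cmod_ge0 _) (le_be hc) (om_le n).
  have h2 := ler_pM (cmod_ge0 _) (cmod_ge0 _) (inv_le n) (inv_le n.+1).
  have h3 := ler_wpM2r (ltW (ratio_gt0 n)) h1.
  apply: le_trans (ler_pM _ _ h3 h2) _; try by rewrite ?mulr_ge0 ?cmod_ge0.
  lra.
have [r_ _ rater] : exists2 r_, r @ \oo --> r_ &
    forall n, cmod (r n - r_) <= 8 * ratio n * series_tail t n.
  apply: summable_steps => // n; first by rewrite mulr_ge0 // ltW.
  by rewrite ler_pM2l.
pose x1 n := x' n - r_ * x n; pose y1 n := y' n - r_ * y n.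
have s1 : sys x1 y1 by exact: planar_system_subZ.
have y1E n : y1 n / P n = (r n - r_) * (y n / Q n) / (P n / Q n).
  by rewrite /y1 /r; field; rewrite P0 Q0 yn0.
have y1c : (fun n => y1 n / P n) @ \oo --> (0 : CC R).
  apply: (@cvg_cmod_le _ _ _ (fun n => 16 * series_tail t n)).
    apply: nearW => n; rewrite subr0 y1E cmodM cmodV -/(ratio n).
    rewrite ler_pdivrMr // cmodM.
    have /andP[_ h] := yQ n.
    apply: le_trans (ler_pM (cmod_ge0 _) (cmod_ge0 _) (rater n) h) _.
    lra.
  by rewrite -(mulr0 16); exact: (cvgM (cvg_cst _) (series_tail_cvg0 t_cvg)).
have x1E n : x1 n / P n =
    om n / (y n / Q n) + x n / Q n / (y n / Q n) * (y1 n / P n).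
  by rewrite /x1 /y1 /om /W; field; rewrite P0 Q0 yn0.
have invc : (fun n => (y n / Q n)^-1) @ \oo --> l^-1.
  exact: (cvgV l0 yl).
have x1c : (fun n => x1 n / P n) @ \oo --> w / l.
  have -> : (fun n => x1 n / P n) = (fun n => om n * (y n / Q n)^-1 +
     x n / Q n / (y n / Q n) * (y1 n / P n)) by apply/funext => n; rewrite x1E.
  rewrite -[w / l]addr0; apply: (cvgD (cvgM oml invc)).
  apply: (@cvg_cmod_le _ _ _ (fun n => 4 * cmod (y1 n / P n))).
    apply: nearW => n; rewrite subr0 cmodM; apply: ler_wpM2r; first exact: cmod_ge0.
    rewrite cmodM; have := ler_pM (cmod_ge0 _) (cmod_ge0 _) (xQ n) (inv_le n); lra.
  rewrite -(mulr0 4); apply: (cvgM (cvg_cst _)).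
  by have := cvg_cmod y1c; rewrite cmod0.
have wl0 : w / l != 0 by rewrite mulf_neq0 ?invr_eq0.
exists (fun n => (w / l)^-1 * x1 n), (fun n => (w / l)^-1 * y1 n); split.
- exact: planar_systemZ.
- have -> : (fun n => (w / l)^-1 * x1 n / P n) =
      (fun n => (w / l)^-1 * (x1 n / P n)).
    by apply/funext => n; rewrite mulrA.
  by rewrite -(mulVf wl0); exact: (cvgM (cvg_cst _) x1c).
- have -> : (fun n => (w / l)^-1 * y1 n / P n) =
      (fun n => (w / l)^-1 * (y1 n / P n)).
    by apply/funext => n; rewrite mulrA.
  by rewrite -(mulr0 (w / l)^-1); exact: (cvgM (cvg_cst _) y1c).
Qed.

End Core.

(** * Absolutely summable complex sequences *)

Section AbsSummable.
Variable R : realType.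
Implicit Types (s u : nat -> R) (f g : nat -> CC R).

Lemma series_cvg_near s u M : (forall n, 0 <= s n) -> (forall n, 0 <= u n) ->
  (\forall n \near \oo, s n <= M * u n) -> cvgn (series u) -> cvgn (series s).
Proof.
move=> s0 u0 [N _ suM] cu.
have sM n : (N <= n)%N -> s n <= `|M| * u n.
  by move=> Nn; apply: le_trans (suM n Nn) _; apply: ler_wpM2r => //;
    exact: ler_norm.
apply: (@bounded_series_cvg _ _ (series s N + `|M| * limn (series u))) => // n.
have ndu : nondecreasing_seq (series u).
  by apply/nondecreasing_seqP => k; rewrite seriesSr lerDl.
apply: (@le_trans _ _ (series s N + `|M| * series u n)); last first.
  by rewrite lerD2l; apply: ler_wpM2l => //; exact: nondecreasing_cvgn_le.
have su0 k : 0 <= series u k by apply: sumr_ge0.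
elim: n => [|n IH].
  by rewrite [X in X <= _]big_geq // addr_ge0 ?mulr_ge0 //; apply: sumr_ge0.
rewrite !seriesSr mulrDr; have [Nn|nN] := leqP N n.
  by have := sM n Nn; move: IH; lra.
apply: (@le_trans _ _ (series s N)); last first.
  by rewrite lerDl -mulrDr mulr_ge0 // addr_ge0.
rewrite -seriesSr; apply: (@nondecreasing_series _ s xpredT) => //.
Qed.

Definition abs_summable f : Prop := cvgn (series (fun n => cmod (f n))).

Lemma abs_summable_near_le f g M :
  (\forall n \near \oo, cmod (f n) <= M * cmod (g n)) ->
  abs_summable g -> abs_summable f.
Proof. by apply: series_cvg_near => n; exact: cmod_ge0. Qed.

Lemma abs_summable_near_eq f g : (\forall n \near \oo, f n = g n) ->
    abs_summable g -> abs_summable f.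
Proof.
by move=> fg; apply: (@abs_summable_near_le _ _ 1); move: fg; apply: filterS =>
  n ->; rewrite mul1r.
Qed.

Lemma abs_summableD f g : abs_summable f -> abs_summable g ->
    abs_summable (fun n => f n + g n).
Proof.
move=> af ag; apply: (@series_cvg_near _ (fun n => cmod (f n) + cmod (g n)) 1).
- by move=> n; exact: cmod_ge0.
- by move=> n; rewrite addr_ge0 ?cmod_ge0.
- by apply: nearW => n; rewrite mul1r ler_cmodD.
by have := is_cvg_seriesD af ag.
Qed.

(** A convergent factor is bounded. *)
Lemma abs_summableM f g (l : CC R) : abs_summable f -> g @ \oo --> l ->
    abs_summable (fun n => f n * g n).
Proof.
move=> af gl; apply: (abs_summable_near_le (M := cmod l + 1)) af.
have := cvg_cmod gl => /cvgrPdist_lt/(_ 1 ltr01); apply: filterS => n h.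
rewrite cmodM mulrC; apply: ler_wpM2r; first exact: cmod_ge0.
by move: h; rewrite ltr_distl => /andP[] *; lra.
Qed.

Lemma abs_summableN f : abs_summable f -> abs_summable (fun n => - f n).
Proof.
by apply: (@abs_summable_near_le _ _ 1); apply: nearW => n; rewrite cmodN mul1r.
Qed.

Lemma cvg_shift1 (T : ptopologicalType) (f : nat -> T) (l : T) :
  f @ \oo --> l -> (fun n => f n.+1) @ \oo --> l.
Proof. by rewrite cvg_shiftS. Qed.

Definition summable_increments f : Prop := abs_summable (fun n => f n.+1 - f n).

Lemma summable_increments_cst (x : CC R) : summable_increments (fun=> x).
Proof.
apply: (@abs_summable_near_le _ (fun=> 0) 1).
  by apply: nearW => n; rewrite subrr cmod0 mulr0.
rewrite /abs_summable.
have -> : (series (fun=> cmod (0 : CC R))) = (fun=> 0).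
  by apply/funext => n; rewrite /series /= cmod0 big1.
exact: is_cvg_cst.
Qed.

Lemma summable_incrementsD f g : summable_increments f -> summable_increments g ->
    summable_increments (fun n => f n + g n).
Proof.
move=> af ag; apply: abs_summable_near_eq (abs_summableD af ag).
by apply: nearW => n; ring.
Qed.

Lemma summable_incrementsN f : summable_increments f ->
    summable_increments (fun n => - f n).
Proof.
by move=> af; apply: abs_summable_near_eq (abs_summableN af); apply: nearW => n;
  ring.
Qed.

Lemma summable_incrementsM f g (k l : CC R) : summable_increments f ->
    summable_increments g -> f @ \oo --> k -> g @ \oo --> l ->
  summable_increments (fun n => f n * g n).
Proof.
move=> af ag fk gl.
apply: abs_summable_near_eq (abs_summableD (abs_summableM af (cvg_shift1 gl))
  (abs_summableM ag fk)).
by apply: nearW => n; ring.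
Qed.

Lemma summable_from1 (u : nat -> R) : (forall n, 0 <= u n) ->
  (\sum_(1 <= n <oo) (u n)%:E < +oo)%E -> cvgn (series u).
Proof.
move=> u0 h.
have S0 : (0 <= \sum_(1 <= n <oo) (u n)%:E)%E by apply: nneseries_ge0 => n _ _;
    rewrite lee_fin.
apply: (@bounded_series_cvg _ _ (u 0%N + fine (\sum_(1 <= n <oo) (u n)%:E)%E))
  => // n.
apply: (@le_trans _ _ (series u n.+1)); first by rewrite seriesSr lerDl.
rewrite /series /= big_nat_recl // lerD2l.
rewrite -lee_fin fineK ?ge0_fin_numE // -sumEFin.
apply: le_trans (@nneseries_lim_ge R (fun n => (u n)%:E) xpredT 1 n.+1 _).
  by rewrite big_add1.
by move=> k _ _; rewrite lee_fin.
Qed.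

Lemma diverges_from1 (u : nat -> R) : (forall n, (1 <= n)%N -> 0 <= u n) ->
  (\sum_(1 <= n <oo) (u n)%:E = +oo)%E ->
  forall M, exists n, M <= \sum_(1 <= k < n) u k.
Proof.
move=> u0 h M; apply: contrapT => /forallNP hM.
suff : (\sum_(1 <= n <oo) (u n)%:E <= M%:E)%E by rewrite h.
apply: lime_le; first by apply: is_cvg_nneseries => n n1 _; rewrite lee_fin u0.
apply: nearW => n; rewrite sumEFin lee_fin; apply/ltW; rewrite ltNge;
  apply/negP; exact: hM.
Qed.

(** The quantity [r n * (1 + S n)], with [S n] the partial sums of [x], does not
    increase, because [(1 - x) * (1 + S + x) <= 1 + S]. *)
Lemma divergent_product_cvg0 (r x : nat -> R) : (forall n, 0 <= r n) ->
  (forall n, 0 <= x n) -> (forall n, r n.+1 <= (1 - x n) * r n) ->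
  (forall M, exists n, M <= series x n) -> r @ \oo --> (0 : R).
Proof.
move=> r0 x0 rS xinf.
have sx0 n : 0 <= series x n by apply: sumr_ge0.
have h n : r n * (1 + series x n) <= r 0%N.
  elim: n => [|n IH]; first by rewrite [series x 0]big_geq // addr0 mulr1.
  apply: le_trans IH; rewrite seriesSr.
  apply: (@le_trans _ _ ((1 - x n) * r n * (1 + (series x n + x n)))).
    by apply: ler_wpM2r => //; rewrite addr_ge0 ?addr_ge0.
  have := mulr_ge0 (r0 n) (mulr_ge0 (x0 n) (sx0 n)).
  have := mulr_ge0 (r0 n) (mulr_ge0 (x0 n) (x0 n)); lra.
apply/cvgr0Pnorm_lt => e e0.
have [N HN] := xinf (r 0%N / e); exists N => // n /= Nn.
rewrite ger0_norm // -(ltr_pM2r (_ : 0 < 1 + series x n)); last first.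
  by rewrite ltr_pwDl.
apply: le_lt_trans (h n) _.
have : series x N <= series x n by apply: (@nondecreasing_series _ x xpredT).
move=> h1; have h2 := le_trans HN h1; rewrite ler_pdivrMr // in h2; lra.
Qed.

End AbsSummable.

Section Entries.
Variables (K : numFieldType) (m n : nat).

Lemma ler_entry_norm (M : 'M[K]_(m, n)) i j : `|M i j| <= `|M|.
Proof.
rewrite [leRHS]/Num.norm /= mx_normE.
have -> : `|M i j| = (`|M i j|%:nng)%:num by [].
rewrite num_le.
exact: (@le_bigmax _ _ _ _ (fun ij : 'I_m * 'I_n => `|M ij.1 ij.2|%:nng) (i, j)).
Qed.

Lemma cvg_entry (F : nat -> 'M[K]_(m, n)) (M : 'M[K]_(m, n)) i j :
  F @ \oo --> M -> (fun k => F k i j) @ \oo --> M i j.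
Proof.
move=> /cvgrPdist_lt FM; apply/cvgrPdist_lt => e /FM; apply: filterS => k /=.
by apply: le_lt_trans; have := ler_entry_norm (M - F k) i j; rewrite !mxE.
Qed.

Lemma cvg_entrywise (F : nat -> 'M[K]_(m, n)) (M : 'M[K]_(m, n)) :
  (forall i j, (fun k => F k i j) @ \oo --> M i j) -> F @ \oo --> M.
Proof.
move=> FM; apply/cvgrPdist_lt => e e0.
have : \forall k \near \oo, forall ij : 'I_m * 'I_n, `|M ij.1 ij.2 - F k ij.1 ij.2|
    < e.
  apply: filter_forall => -[i j] /=; have /cvgrPdist_lt := FM i j; exact.
apply: filterS => k h; rewrite [ltLHS]/Num.norm /= mx_normE.
have [r re] : exists r : {nonneg K}, e = r%:num by exists (NngNum (ltW e0)).
rewrite re num_lt; apply/bigmax_ltP => /=.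
split=> [|ij _]; first by rewrite -num_lt /= -re.
by rewrite -num_lt /= -re !mxE.
Qed.

End Entries.

(** * Plane vectors, eigenvectors and solution spaces *)

Section Planar.
Variable K : fieldType.
Implicit Types (v w f : 'cV[K]_2) (M : 'M[K]_2).

Lemma ord2_cases (i : 'I_2) : i = 0 \/ i = 1.
Proof. by case: i => [[|[|n]]] // h; [left|right]; apply: val_inj. Qed.

Lemma col2P v w : v 0 0 = w 0 0 -> v 1 0 = w 1 0 -> v = w.
Proof.
move=> h0 h1; apply/matrixP => i j; rewrite (ord1 j).
by case: (ord2_cases i) => ->.
Qed.

Lemma sum_ord2 (F : 'I_2 -> K) : \sum_i F i = F 0 + F 1.
Proof. by rewrite big_ord_recl big_ord1; congr (_ + F _); apply: val_inj. Qed.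

Lemma mulmx2_col M v i : (M *m v) i 0 = M i 0 * v 0 0 + M i 1 * v 1 0.
Proof. by rewrite mxE sum_ord2. Qed.

Lemma mxtrace2 M : \tr M = M 0 0 + M 1 1.
Proof. exact: sum_ord2. Qed.

Lemma det_mx2 M : \det M = M 0 0 * M 1 1 - M 0 1 * M 1 0.
Proof.
rewrite (expand_det_row _ 0) sum_ord2 /cofactor !det_mx11 !mxE /= expr0 expr1.
have -> : lift 0 0 = 1 :> 'I_2 by apply: val_inj.
have -> : lift 1 0 = 0 :> 'I_2 by apply: val_inj.
by ring.
Qed.

Definition cross v w : K := v 0 0 * w 1 0 - v 1 0 * w 0 0.

Lemma cross_cramer v w f : cross v w *: f = cross f w *: v + cross v f *: w.
Proof. by apply: col2P; rewrite /cross !mxE; ring. Qed.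

Lemma crossZZ a b v w : cross (a *: v) (b *: w) = a * b * cross v w.
Proof. by rewrite /cross !mxE; ring. Qed.

(** Cramer's rule expresses the forcing vectors in the new frame, which turns one
    step of the vector recursion into one step of a planar system. *)
Lemma planar_step v w f g (al be x y : K) : cross v w != 0 ->
  x *: (al *: v + f) + y *: (be *: w + g) =
  ((al + cross f w / cross v w) * x + cross g w / cross v w * y) *: v +
  (cross v f / cross v w * x + (be + cross v g / cross v w) * y) *: w.
Proof.
move=> D0.
have E h : h = (cross h w / cross v w) *: v + (cross v h / cross v w) *: w.
  by rewrite ![_ / _]mulrC -!scalerA -scalerDr -cross_cramer scalerA mulVf ?scale1r.
rewrite [in LHS](E f) [in LHS](E g).
move: (cross f w / _) (cross v f / _) (cross g w / _) (cross v g / _) => a c b d.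
by apply: col2P; rewrite !mxE; ring.
Qed.

Lemma eigenvalue_pairP M a b : eigenvalue_pair M a b ->
    \tr M = a + b /\ \det M = a * b.
Proof.
rewrite /eigenvalue_pair => e.
have E : ('X - a%:P) * ('X - b%:P) = 'X^2 - (a + b) *: 'X + (a * b)%:P.
  by rewrite -mul_polyC rmorphD rmorphM /=; ring.
split.
  have := char_poly_trace M (ltn0Sn 1); rewrite e E /=.
  rewrite !(coefD, coefN, coefZ, coefXn, coefX, coefC) /= mulr1 addr0 sub0r.
  by move/oppr_inj.
have := char_poly_det M; rewrite e E.
rewrite !(coefD, coefN, coefZ, coefXn, coefX, coefC) /= mulr0 subr0 add0r.
by rewrite expr2 mulrNN !mul1r.
Qed.

Lemma eigenvalue_pairC M a b : eigenvalue_pair M a b -> eigenvalue_pair M b a.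
Proof. by rewrite /eigenvalue_pair mulrC. Qed.

Lemma eigenvalue_pair_discr M a b : eigenvalue_pair M a b -> discr M = (a - b) ^+ 2.
Proof. by move=> /eigenvalue_pairP[h1 h2]; rewrite /discr h1 h2; ring. Qed.

(** Cayley-Hamilton: [(M - a) (M - b) = 0]. This gives eigenvectors of [V_n] which
    depend on [V_n] and on its eigenvalues polynomially. *)
Lemma eigenprojection M a b v : eigenvalue_pair M a b ->
  M *m (M *m v - b *: v) = a *: (M *m v - b *: v).
Proof.
move=> /eigenvalue_pairP[]; rewrite mxtrace2 det_mx2 => h1 h2.
have e1 : b = M 0 0 + M 1 1 - a by rewrite h1; ring.
have e2 : M 0 0 * M 1 1 - M 0 1 * M 1 0 = a * (M 0 0 + M 1 1 - a) by rewrite h2 -e1.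
apply: col2P; rewrite !mulmx2_col !mxE !sum_ord2 e1.
  apply/eqP; rewrite -subr_eq0; apply/eqP.
  transitivity (- v 0 0 * (M 0 0 * M 1 1 - M 0 1 * M 1 0
    - a * (M 0 0 + M 1 1 - a))); first by ring.
  by rewrite e2; ring.
apply/eqP; rewrite -subr_eq0; apply/eqP.
transitivity (- v 1 0 * (M 0 0 * M 1 1 - M 0 1 * M 1 0 - a * (M 0 0 + M 1 1 - a)));
  first by ring.
by rewrite e2; ring.
Qed.

Lemma cross_eigenvectors M a b v w : a != b -> eigenvector M a v ->
  eigenvector M b w -> cross v w != 0.
Proof.
move=> ab [v0 Mv] [w0 Mw]; apply/eqP => c0.
have c0' : v 0 0 * w 1 0 = v 1 0 * w 0 0 by apply/eqP; rewrite -subr_eq0; apply/eqP.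
have [i vi] : exists i, v i 0 != 0.
  apply: contrapT => /forallNP h; case/eqP: v0.
  by apply: col2P; rewrite mxE; apply/eqP/negPn/negP/h.
have e : w = (w i 0 / v i 0) *: v.
  have e' : v i 0 *: w = w i 0 *: v.
    by case: (ord2_cases i) => ->; apply: col2P; rewrite !mxE;
      first [by ring | by rewrite c0'; ring | by rewrite -c0'; ring].
  by rewrite mulrC -scalerA -e' scalerA mulVf ?scale1r.
have := Mw; rewrite e -scalemxAr Mv !scalerA => /eqP.
rewrite -subr_eq0 -scalerBl scaler_eq0 (negPf v0) orbF mulrC -mulrBl mulf_eq0
  subr_eq0 (negPf ab) /=.
by move/eqP => s0; move: w0; rewrite e s0 scale0r eqxx.
Qed.

Section Solutions.
Variable A : nat -> 'M[K]_2.
Hypothesis A_inv : forall n, (1 <= n)%N -> \det (A n) != 0.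

Let A_unit n : (1 <= n)%N -> A n \in unitmx.
Proof. by move=> n1; rewrite unitmxE unitfE A_inv. Qed.

Lemma solution_at_exists N v : (1 <= N)%N -> exists u, solution A u /\ u N = v.
Proof.
elim: N v => // -[_ v _|N IH v _].
  pose u := fix u n := if n is m.+1 then (if m is 0%N then v else A m *m u m) else
      0.
  by exists u; split=> // -[|n].
have [u [su uN]] := IH (invmx (A N.+1) *m v) isT.
by exists u; split=> //; rewrite su // uN mulKVmx ?A_unit.
Qed.

Lemma solution_eq (u w : nat -> 'cV[K]_2) N : solution A u -> solution A w ->
    (1 <= N)%N ->
  u N = w N -> forall n, (1 <= n)%N -> u n = w n.
Proof.
move=> su sw N1 e.
have e1 : u 1%N = w 1%N.
  elim: N N1 e => // -[//|N] IH _; rewrite su // sw // => e; apply: IH => //.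
  by rewrite -(mulKmx (A_unit (ltn0Sn N)) (u N.+1)) e mulKmx ?A_unit.
by elim=> // -[//|n] IH _; rewrite su // sw // IH.
Qed.

Lemma solution_from N (u' : nat -> 'cV[K]_2) : (1 <= N)%N ->
  (forall k, u' k.+1 = A (N + k)%N *m u' k) ->
  exists u, solution A u /\ forall k, u (N + k)%N = u' k.
Proof.
move=> N1 hu; have [u [su uN]] := solution_at_exists (u' 0%N) N1.
exists u; split=> //; elim=> [|k IH]; first by rewrite addn0.
by rewrite addnS su ?IH ?hu // addn_gt0 N1.
Qed.

Lemma solutionZD a b (u w : nat -> 'cV[K]_2) : solution A u -> solution A w ->
  solution A (fun n => a *: u n + b *: w n).
Proof. by move=> su sw n n1; rewrite su // sw // mulmxDr -!scalemxAr. Qed.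

(** Independence at one time is enough, because the flow is invertible: solutions
    that agree once agree always. *)
Lemma solution_basis_of_cross (u w : nat -> 'cV[K]_2) N : solution A u ->
    solution A w -> (1 <= N)%N ->
  cross (u N) (w N) != 0 -> solution_basis A u w.
Proof.
move=> su sw N1 c0; split=> // [a b /(_ N N1) h|z sz].
  split.
    have : cross (a *: u N + b *: w N) (w N) = 0 by rewrite h /cross !mxE; ring.
    have -> : cross (a *: u N + b *: w N) (w N) = a * cross (u N) (w N).
      by rewrite /cross !mxE; ring.
    by move/eqP; rewrite mulf_eq0 (negPf c0) orbF => /eqP.
  have : cross (u N) (a *: u N + b *: w N) = 0 by rewrite h /cross !mxE; ring.
  have -> : cross (u N) (a *: u N + b *: w N) = b * cross (u N) (w N).
    by rewrite /cross !mxE; ring.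
  by move/eqP; rewrite mulf_eq0 (negPf c0) orbF => /eqP.
exists (cross (z N) (w N) / cross (u N) (w N)),
  (cross (u N) (z N) / cross (u N) (w N)).
apply: (solution_eq (N := N)) => //; first exact: solutionZD.
by rewrite ![_ / _]mulrC -!scalerA -scalerDr -cross_cramer scalerA mulVf ?scale1r.
Qed.

End Solutions.
End Planar.

Lemma nzprod_neq0 (K : idomainType) (c : nat -> K) n : nzprod c n != 0.
Proof. by rewrite /nzprod prodf_seq_neq0; apply/allP => i _; apply/implyP. Qed.

Lemma nzprod_add (K : idomainType) (c : nat -> K) N :
  (forall k, c (N.+1 + k)%N != 0) -> forall k,
  nzprod c (N + k)%N = nzprod c N * \prod_(j < k) c (N.+1 + j)%N.
Proof.
move=> c0; elim=> [|k IH]; first by rewrite addn0 big_ord0 mulr1.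
rewrite addnS /nzprod big_mkcond big_nat_recr //= -big_mkcond -/(nzprod c _) IH.
by rewrite -addSn c0 big_ord_recr /= mulrA.
Qed.

(** * From moving frames to diagonal systems *)

Lemma cvg_shiftl (T : ptopologicalType) (f : nat -> T) (l : T) N :
  f @ \oo --> l -> (fun k => f (N + k)%N) @ \oo --> l.
Proof.
have -> : (fun k => f (N + k)%N) = [sequence f (n + N)%N]_n.
  by apply/funext => k; rewrite addnC.
by rewrite cvg_shiftn.
Qed.

Section Vectors.
Variable R : realType.
Local Notation C := (CC R).
Implicit Types (F G : nat -> 'cV[C]_2) (v w : 'cV[C]_2).

Definition cvg_coords F v := forall i, (fun n => F n i 0) @ \oo --> v i 0.
Definition abs_summable_coords F := forall i, abs_summable (fun n => F n i 0).

Lemma cvg_cross F G v w : cvg_coords F v -> cvg_coords G w ->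
  (fun n => cross (F n) (G n)) @ \oo --> cross v w.
Proof.
by move=> Fv Gw; exact: (cvgB (cvgM (Fv 0) (Gw 1)) (cvgM (Fv 1) (Gw 0))).
Qed.

Lemma abs_summable_crossl F G w : abs_summable_coords F -> cvg_coords G w ->
    abs_summable (fun n => cross (F n) (G n)).
Proof.
by move=> aF Gw; exact: (abs_summableD (abs_summableM (aF 0) (Gw 1))
  (abs_summableN (abs_summableM (aF 1) (Gw 0)))).
Qed.

Lemma abs_summable_crossr F G w : abs_summable_coords F -> cvg_coords G w ->
    abs_summable (fun n => cross (G n) (F n)).
Proof.
move=> aF Gw; apply: abs_summable_near_eq
  (abs_summableN (abs_summable_crossl aF Gw)).
by apply: nearW => n; rewrite /cross; ring.
Qed.

Lemma cvg_coords_shift1 F v : cvg_coords F v -> cvg_coords (fun n => F n.+1) v.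
Proof. by move=> Fv i; exact: cvg_shift1 (Fv i). Qed.

(** A solution of the planar system that starts at time [N.+1] is carried back to
    time [1] by the invertible flow. The nonzero factors of [c] up to [N] only
    contribute the constant [nzprod c N]. *)
Lemma lift_solution (A : nat -> 'M[C]_2) (c x y : nat -> C) F G v w (k : C) N :
  (forall n, (1 <= n)%N -> \det (A n) != 0) ->
  (forall n, c (N.+1 + n)%N != 0) -> c @ \oo --> (1 : C) ->
  cvg_coords F (k *: v) -> k != 0 -> cvg_coords G w ->
  (fun n => x n / \prod_(j < n) c (N.+1 + j)%N) @ \oo --> (1 : C) ->
  (fun n => y n / \prod_(j < n) c (N.+1 + j)%N) @ \oo --> (0 : C) ->
  (forall n, x n.+1 *: F (N.+1 + n.+1)%N + y n.+1 *: G (N.+1 + n.+1)%N =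
     A (N.+1 + n)%N *m (x n *: F (N.+1 + n)%N + y n *: G (N.+1 + n)%N)) ->
  exists u, solution A u /\ asymptotics u (nzprod c) v.
Proof.
move=> A_inv c0 c1 Fv k0 Gw xP yP rec.
(* The scalar [nzprod c N / k] absorbs the factors before [N.+1] and the
   normalisation of the frame. *)
pose u' n := (nzprod c N / k) *: (x n *: F (N.+1 + n)%N + y n *: G (N.+1 + n)%N).
have [u [su uN]] : exists u, solution A u /\ forall n, u (N.+1 + n)%N = u' n.
  by apply: solution_from => // n; rewrite /u' rec -scalemxAr.
exists u; split=> //.
exists (fun n => (nzprod c n)^-1 *: u n - v); split; last first.
  by move=> n _; rewrite addrC subrK scalerA divff ?scale1r // nzprod_neq0.
rewrite -(cvg_shiftn N.+1).
apply: cvg_entrywise => i j; rewrite (ord1 j) !mxE /=.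
have P0 n : \prod_(j < n) c (N.+1 + j)%N != 0 by apply/prodf_neq0.
have -> : (fun n => ((nzprod c (n + N.+1)%N)^-1 *: u (n + N.+1)%N - v) i 0) =
  (fun n => k^-1 * (c (N.+1 + n)%N)^-1 *
    (x n / (\prod_(j < n) c (N.+1 + j)%N) * F (N.+1 + n)%N i 0
     + y n / (\prod_(j < n) c (N.+1 + j)%N) * G (N.+1 + n)%N i 0) - v i 0).
  apply/funext => n; rewrite !mxE [(n + N.+1)%N]addnC uN /u' !mxE addSnnS.
  rewrite nzprod_add // -addSnnS big_ord_recr /=.
  by field; rewrite c0 P0 k0 nzprod_neq0.
have -> : 0 = k^-1 * 1^-1 * (1 * (k * v i 0) + 0 * w i 0) - v i 0 :> C.
  by rewrite invr1; field.
have h1 : (fun n => (c (N.+1 + n)%N)^-1) @ \oo --> (1^-1 : C).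
  exact: (cvgV (oner_neq0 C) (cvg_shiftl N.+1 c1)).
have h2 : (fun n => F (N.+1 + n)%N i 0) @ \oo --> k * v i 0.
  by have := cvg_shiftl N.+1 (Fv i); rewrite mxE.
have h3 := cvg_shiftl N.+1 (Gw i).
exact: (cvgB (cvgM (cvgM (cvg_cst k^-1) h1) (cvgD (cvgM xP h2) (cvgM yP h3)))
  (cvg_cst (v i 0))).
Qed.

Section Perturbed.
Variables (A : nat -> 'M[C]_2) (al be : nat -> C) (F G f g : nat -> 'cV[C]_2).
Variables (v w : 'cV[C]_2) (k l : C).
Hypothesis A_inv : forall n, (1 <= n)%N -> \det (A n) != 0.
Hypotheses (al1 : al @ \oo --> (1 : C)) (be1 : be @ \oo --> (1 : C)).
Hypotheses (Fv : cvg_coords F (k *: v)) (k0 : k != 0) (Gw : cvg_coords G (l *: w))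
  (l0 : l != 0).
Hypothesis vw : cross v w != 0.
Hypotheses (af : abs_summable_coords f) (ag : abs_summable_coords g).
Hypothesis AF : forall n, (1 <= n)%N -> A n *m F n = al n *: F n.+1 + f n.
Hypothesis AG : forall n, (1 <= n)%N -> A n *m G n = be n *: G n.+1 + g n.

(** In the frame [(F n, G n)], which converges to multiples of the independent
    vectors [v], [w], the recursion is a perturbed diagonal system with absolutely
    summable errors. From a late enough time on, the diagonal entries and the
    determinant of the frame are nonzero, and the errors relative to [al] sum to
    at most [16^-1]. *)
Lemma reduction_to_planar N0 : exists N a b c d t, (N0 <= N)%N /\
  [/\ (forall n, al (N.+1 + n)%N != 0), (forall n, be (N.+1 + n)%N != 0),
      forall n, 0 <= t n, forall n, series t n <= 16^-1 &
  (forall n,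
    [/\ cmod (a n) <= t n * cmod (al (N.+1 + n)%N),
        cmod (b n) <= t n * cmod (al (N.+1 + n)%N),
        cmod (c n) <= t n * cmod (al (N.+1 + n)%N) &
        cmod (d n) <= t n * cmod (al (N.+1 + n)%N)])
  /\ forall x y, planar_system (fun n => al (N.+1 + n)%N) (fun n => be (N.+1 + n)%N)
    a b c d x y ->
    forall n, x n.+1 *: F (N.+1 + n.+1)%N + y n.+1 *: G (N.+1 + n.+1)%N =
     A (N.+1 + n)%N *m (x n *: F (N.+1 + n)%N + y n *: G (N.+1 + n)%N)].
Proof.
pose D n := cross (F n) (G n).
have D0 : cross (k *: v) (l *: w) != 0 by rewrite crossZZ !mulf_neq0.
have Dc : D @ \oo --> cross (k *: v) (l *: w) := cvg_cross Fv Gw.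
have F1 := cvg_coords_shift1 Fv; have G1 := cvg_coords_shift1 Gw.
have iD : (fun n => (D n.+1)^-1) @ \oo --> (cross (k *: v) (l *: w))^-1.
  exact: (cvgV D0 (cvg_shift1 Dc)).
have ial : (fun n => (al n)^-1) @ \oo --> (1^-1 : C)
    by exact: (cvgV (oner_neq0 C) al1).
pose a n := cross (f n) (G n.+1) / D n.+1.
pose b n := cross (g n) (G n.+1) / D n.+1.
pose c n := cross (F n.+1) (f n) / D n.+1.
pose d n := cross (F n.+1) (g n) / D n.+1.
have sum_of h : abs_summable h -> abs_summable (fun n => h n / D n.+1 / al n).
  move=> ah; apply: abs_summable_near_eq (abs_summableM ah (cvgM iD ial)).
  by apply: nearW => n /=; rewrite mulrA.
have aa := sum_of _ (abs_summable_crossl af G1).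
have ab := sum_of _ (abs_summable_crossl ag G1).
have ac := sum_of _ (abs_summable_crossr af F1).
have ad := sum_of _ (abs_summable_crossr ag F1).
pose T n := cmod (a n / al n) + cmod (b n / al n)
    + cmod (c n / al n) + cmod (d n / al n).
have T0 n : 0 <= T n by rewrite !addr_ge0 ?cmod_ge0.
have Tc : cvgn (series T).
  exact: (is_cvg_seriesD (is_cvg_seriesD (is_cvg_seriesD aa ab) ac) ad).
have near_neq0 (h : nat -> C) (z : C) : h @ \oo --> z -> z != 0 ->
    \forall n \near \oo, h n != 0.
  move=> hz z0; exact: (cvgr_neq0 z hz z0).
have [N [NN0 alN beN DN TN]] : exists N,
    [/\ (N0 <= N)%N, forall n, (N <= n)%N -> al n != 0,
    forall n, (N <= n)%N -> be n != 0, forall n, (N <= n)%N -> D n != 0 &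
      series_tail T N.+1 <= 16^-1].
  have [N1 _ H1] := near_neq0 _ _ al1 (oner_neq0 C).
  have [N2 _ H2] := near_neq0 _ _ be1 (oner_neq0 C).
  have [N3 _ H3] := near_neq0 _ _ Dc D0.
  have i16 : 0 < 16^-1 :> R by rewrite invr_gt0.
  have [N4 _ H4] := proj1 (@cvgr0Pnorm_lt _ _ _ _ _ (series_tail T))
      (series_tail_cvg0 Tc) _ i16.
  exists (maxn N0 (maxn (maxn N1 N2) (maxn N3 N4))).
  have m0 := leq_maxl N0 (maxn (maxn N1 N2) (maxn N3 N4)).
  have mr := leq_maxr N0 (maxn (maxn N1 N2) (maxn N3 N4)).
  move: mr; rewrite {1}geq_max {1}[(maxn N1 N2 <= _)%N]geq_max
    {1}[(maxn N3 N4 <= _)%N]geq_max.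
  move=> /andP[/andP[m1 m2] /andP[m3 m4]].
  split=> // [n h|n h|n h|].
  - by apply: H1; exact: leq_trans m1 h.
  - by apply: H2; exact: leq_trans m2 h.
  - by apply: H3; exact: leq_trans m3 h.
  by apply: le_trans (ler_norm _) (ltW (H4 _ _)); exact: leq_trans m4 (leqnSn _).
have le_N n : (N <= N.+1 + n)%N by rewrite addSn (leq_trans (leq_addr n N)).
pose s (h : nat -> C) n := h (N.+1 + n)%N.
exists N, (s a), (s b), (s c), (s d), (fun n => T (N.+1 + n)%N); split=> //.
split.
- by move=> n; exact: alN.
- by move=> n; exact: beN.
- by move=> n.
- move=> n; apply: le_trans TN.
  rewrite series_shift; exact: series_le_tail.
split=> [n|x y sxy n]; last first.
  rewrite mulmxDr -!scalemxAr AF // AG // planar_step; last by apply: DN;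
    rewrite -addnS le_N.
  by have [-> ->] := sxy n; rewrite addnS.
have ca0 : 0 < cmod (al (N.+1 + n)%N) by rewrite cmod_gt0 alN.
have E h : cmod (h / al (N.+1 + n)%N) * cmod (al (N.+1 + n)%N) = cmod h.
  by rewrite cmodM cmodV mulfVK // gt_eqF.
rewrite /s -(E (a (N.+1 + n)%N)) -(E (b (N.+1 + n)%N)) -(E (c (N.+1 + n)%N))
  -(E (d (N.+1 + n)%N)) !ler_pM2r // /T.
have q1 := cmod_ge0 (a (N.+1 + n)%N / al (N.+1 + n)%N).
have q2 := cmod_ge0 (b (N.+1 + n)%N / al (N.+1 + n)%N).
have q3 := cmod_ge0 (c (N.+1 + n)%N / al (N.+1 + n)%N).
have q4 := cmod_ge0 (d (N.+1 + n)%N / al (N.+1 + n)%N).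
by split; lra.
Qed.

Lemma subdominant_vector : (\forall n \near \oo, cmod (al n) <= cmod (be n)) ->
  exists u, solution A u /\ asymptotics u (nzprod al) v.
Proof.
move=> [N0 _ albe].
have [N [a [b [c [d [t [NN0 [al0 be0 t0 ts [small rec]]]]]]]]] :=
    reduction_to_planar N0.
have albe' n : cmod (al (N.+1 + n)%N) <= cmod (be (N.+1 + n)%N).
  by apply: albe => /=; rewrite (leq_trans NN0) // addSn (leq_trans (leq_addr n N)).
have [x [y [sxy xP yP]]] := subdominant_solution al0 be0 albe' t0 ts small.
exact: (lift_solution A_inv al0 al1 Fv k0 Gw xP yP (rec _ _ sxy)).
Qed.

(** The gap [h], not summable, forces the quotient of the two products to zero;
    this is what removes the [F]-component of the growing solution. *)
Lemma dominant_vector (h : nat -> R) : (forall n, 0 <= h n) ->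
  (forall N M, exists n, M <= series (fun k => h (N + k)%N) n) ->
  (\forall n \near \oo, cmod (al n) <= (1 - h n) * cmod (be n)) ->
  exists u, solution A u /\ asymptotics u (nzprod be) w.
Proof.
move=> h0 hinf [N0 _ albe].
have [N [a [b [c [d [t [NN0 [al0 be0 t0 ts [small rec]]]]]]]]] :=
    reduction_to_planar N0.
have albe1 n : cmod (al (N.+1 + n)%N) <=
    (1 - h (N.+1 + n)%N) * cmod (be (N.+1 + n)%N).
  by apply: albe => /=; rewrite (leq_trans NN0) // addSn (leq_trans (leq_addr n N)).
have albe' n : cmod (al (N.+1 + n)%N) <= cmod (be (N.+1 + n)%N).
  apply: le_trans (albe1 n) _; rewrite -[leRHS]mul1r.
  by apply: ler_wpM2r; rewrite ?cmod_ge0 // gerBl.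
have ratio0 : (fun n => cmod (\prod_(k < n) al (N.+1 + k)%N
    / \prod_(k < n) be (N.+1 + k)%N)) @ \oo --> (0 : R).
  apply: (@divergent_product_cvg0 _ _ (fun n => h (N.+1 + n)%N)) => // [n|n].
    exact: cmod_ge0.
  rewrite !big_ord_recr /= invfM mulrACA (cmodM _ (al _ / _)) [leLHS]mulrC.
  apply: ler_wpM2r; first exact: cmod_ge0.
  by rewrite cmodM cmodV ler_pdivrMr ?cmod_gt0.
have [x [y [sxy xQ yQ]]] := dominant_solution al0 be0 albe' t0 ts small ratio0.
apply: (lift_solution A_inv be0 be1 Gw l0 Fv yQ xQ) => n.
by rewrite addrC rec // addrC.
Qed.

End Perturbed.
End Vectors.

(** * Eigenvalues of a convergent sequence of real matrices *)

Section Eigenvalues.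
Variable R : realType.
Local Notation C := (CC R).
Implicit Types (M V : 'M[R]_2) (a b : C).

Lemma cvg_RtoC (f : nat -> R) (l : R) : f @ \oo --> l ->
  (fun n => RtoC (f n)) @ \oo --> RtoC l.
Proof.
move=> fl; apply: (@cvg_cmod_le _ _ _ (fun n => `|f n - l|)).
  by apply: nearW => n; rewrite -rmorphB cmod_RtoC.
apply/norm_cvg0P; rewrite -(subrr l).
by apply: cvgB => //; exact: cvg_cst.
Qed.

Lemma cvg_Re (f : nat -> C) (l : C) : f @ \oo --> l ->
  (fun n => complex.Re (f n)) @ \oo --> complex.Re l.
Proof.
move=> /cvg_cmodP fl; apply/subr_cvg0/norm_cvg0P.
apply: (squeeze_cvgr _ (cvg_cst (0 : R)) fl); apply: nearW => n.
by rewrite normr_ge0 /= -(raddfB (@complex.Re R)) ler_Re_cmod.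
Qed.

Lemma trace_mxRtoC M : \tr (mxRtoC M) = RtoC (\tr M).
Proof. by rewrite !mxtrace2 !mxE rmorphD. Qed.

Lemma det_mxRtoC M : \det (mxRtoC M) = RtoC (\det M).
Proof. by rewrite !det_mx2 !mxE rmorphB !rmorphM. Qed.

Lemma discr_mxRtoC M : discr (mxRtoC M) = RtoC (discr M).
Proof.
by rewrite /discr trace_mxRtoC det_mxRtoC rmorphB rmorphXn rmorphM rmorph_nat.
Qed.

Lemma eigenvalues_RtoC M a b : eigenvalue_pair (mxRtoC M) a b ->
  a + b = RtoC (\tr M) /\ (a - b) ^+ 2 = RtoC (discr M).
Proof.
move=> e; have [h1 h2] := eigenvalue_pairP e.
by rewrite -discr_mxRtoC (eigenvalue_pair_discr e) -h1 trace_mxRtoC.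
Qed.

(** The trace is real, and the square of the difference of the eigenvalues is the
    discriminant, also real. *)
Lemma eigenvalues_ReIm M a b : eigenvalue_pair (mxRtoC M) a b ->
  [/\ complex.Im a + complex.Im b = 0,
     (complex.Re a - complex.Re b) ^+ 2
       - (complex.Im a - complex.Im b) ^+ 2 = discr M &
     (complex.Re a - complex.Re b) * (complex.Im a - complex.Im b) = 0].
Proof.
move=> /eigenvalues_RtoC; case: a => a1 a2; case: b => b1 b2.
rewrite expr2 => -[[_ h2] [h3 h4]] /=; split=> //; lra.
Qed.

Lemma eigenvalues_real M a b : eigenvalue_pair (mxRtoC M) a b -> 0 < discr M ->
  complex.Im a = 0 /\ complex.Im b = 0.
Proof.
move=> /eigenvalues_ReIm[h1 h2 /eqP]; rewrite mulf_eq0 => /orP[|] /eqP h3.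
  by rewrite -h2 h3 expr0n sub0r oppr_gt0 ltNge sqr_ge0.
by move=> _; split; lra.
Qed.

Lemma eigenvalues_conj M a b : eigenvalue_pair (mxRtoC M) a b -> discr M < 0 ->
  complex.Re a = complex.Re b /\ complex.Im a = - complex.Im b.
Proof.
move=> /eigenvalues_ReIm[h1 h2 /eqP]; rewrite mulf_eq0 => /orP[|] /eqP h3.
  by move=> _; split; lra.
by rewrite -h2 h3 expr0n subr0 ltNge sqr_ge0.
Qed.

Lemma cmod_eq_conj a b (p : R) : complex.Re a = complex.Re b ->
  complex.Im a = - complex.Im b -> cmod (1 + RtoC p * a) = cmod (1 + RtoC p * b).
Proof.
move=> hr hi; apply/eqP; rewrite -(@eqrXn2 _ 2) ?cmod_ge0 // !cmodE.
move: hr hi; case: a => a1 a2; case: b => b1 b2 /= -> ->.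
by apply/eqP; ring.
Qed.

Lemma eigenvalue_pair_exists (K : closedFieldType) (M : 'M[K]_2) :
  exists a b : K, eigenvalue_pair M a b.
Proof.
have [r hr] := closed_field_poly_normal (char_poly M).
have := size_char_poly M; rewrite {1}hr (monicP (char_poly_monic M)) scale1r.
rewrite size_prod_XsubC; case: r hr => [|a [|b [|c r]]] // hr _.
exists a, b; rewrite /eigenvalue_pair hr (monicP (char_poly_monic M)) scale1r.
by rewrite !big_cons big_nil mulr1.
Qed.

End Eigenvalues.

Section Labelling.
Variables (R : realType) (V_ : nat -> 'M[R]_2) (V : 'M[R]_2).
Local Notation C := (CC R).
Hypothesis V_cvg : V_ @ \oo --> V.

Lemma cvg_mxRtoC i j : (fun n => mxRtoC (V_ n) i j) @ \oo --> mxRtoC V i j.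
Proof.
rewrite mxE; have := cvg_RtoC (cvg_entry (i := i) (j := j) V_cvg).
by apply: cvg_trans; apply: near_eq_cvg; apply: nearW => n; rewrite mxE.
Qed.

Lemma cvg_trace_mxRtoC : (fun n => \tr (mxRtoC (V_ n))) @ \oo --> \tr (mxRtoC V).
Proof.
have -> : (fun n => \tr (mxRtoC (V_ n))) =
   (fun n => mxRtoC (V_ n) 0 0 + mxRtoC (V_ n) 1 1).
  by apply/funext => n; rewrite mxtrace2.
by rewrite mxtrace2; exact: (cvgD (@cvg_mxRtoC 0 0) (@cvg_mxRtoC 1 1)).
Qed.

Lemma cvg_det_mxRtoC : (fun n => \det (mxRtoC (V_ n))) @ \oo --> \det (mxRtoC V).
Proof.
have -> : (fun n => \det (mxRtoC (V_ n))) =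
   (fun n => mxRtoC (V_ n) 0 0 * mxRtoC (V_ n) 1 1
     - mxRtoC (V_ n) 0 1 * mxRtoC (V_ n) 1 0).
  by apply/funext => n; rewrite det_mx2.
rewrite det_mx2; exact: (cvgB (cvgM (@cvg_mxRtoC 0 0) (@cvg_mxRtoC 1 1))
  (cvgM (@cvg_mxRtoC 0 1) (@cvg_mxRtoC 1 0))).
Qed.

Lemma cvg_discr : (fun n => discr (V_ n)) @ \oo --> discr V.
Proof.
have h := cvg_Re (cvg_trace_mxRtoC); have h' := cvg_Re (cvg_det_mxRtoC).
have tE (M : 'M[R]_2) : complex.Re (\tr (mxRtoC M)) = \tr M :> R
    by rewrite trace_mxRtoC.
have dE (M : 'M[R]_2) : complex.Re (\det (mxRtoC M)) = \det M :> R
    by rewrite det_mxRtoC.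
have -> : (fun n => discr (V_ n)) = (fun n =>
   complex.Re (\tr (mxRtoC (V_ n))) * complex.Re (\tr (mxRtoC (V_ n)))
   - 4%:R * complex.Re (\det (mxRtoC (V_ n)))).
  by apply/funext => n; rewrite tE dE /discr expr2.
have -> : discr V = complex.Re (\tr (mxRtoC V)) * complex.Re (\tr (mxRtoC V))
   - 4%:R * complex.Re (\det (mxRtoC V)) by rewrite tE dE /discr expr2.
exact: (cvgB (cvgM h h) (cvgM (cvg_cst (4%:R : R)) h')).
Qed.

(** Label by proximity to [mu1]: the characteristic polynomial of [V_ n] at [mu1] is
    the product of the two differences with the eigenvalues and tends to zero,
    hence so does the square of the smaller distance. *)
Lemma eigenvalue_labelling_exists (mu1 mu2 : C) :
  eigenvalue_pair (mxRtoC V) mu1 mu2 ->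
  exists mu1_ mu2_, eigenvalue_labelling V_ mu1 mu2 mu1_ mu2_.
Proof.
move=> /eigenvalue_pairP[tV dV].
have pick n : exists ab : C * C, eigenvalue_pair (mxRtoC (V_ n)) ab.1 ab.2 /\
    cmod (ab.1 - mu1) <= cmod (ab.2 - mu1).
  have [a [b e]] := eigenvalue_pair_exists (mxRtoC (V_ n)).
  have [ab|ba] := leP (cmod (a - mu1)) (cmod (b - mu1)); first by exists (a, b).
  by exists (b, a); split; [exact: eigenvalue_pairC|exact: ltW].
have [ab hab] := choice pick.
exists (fun n => (ab n).1), (fun n => (ab n).2).
pose chi n := mu1 * mu1 - \tr (mxRtoC (V_ n)) * mu1 + \det (mxRtoC (V_ n)).
have chi0 : chi @ \oo --> (0 : C).
  have -> : 0 = mu1 * mu1 - \tr (mxRtoC V) * mu1 + \det (mxRtoC V).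
    by rewrite tV dV; ring.
  exact: (cvgD (cvgB (cvg_cst (mu1 * mu1)) (cvgM cvg_trace_mxRtoC (cvg_cst mu1)))
    cvg_det_mxRtoC).
have a_cvg : (fun n => (ab n).1) @ \oo --> mu1.
  apply/cvg_cmodP/cvgr0Pnorm_lt => e e0.
  have e2 : 0 < e ^+ 2 by rewrite exprn_gt0.
  move/cvg_cmodP/cvgr0Pnorm_lt : chi0 => /(_ _ e2); apply: filterS => n /=.
  rewrite !ger0_norm ?cmod_ge0 // subr0.
  have [/eigenvalue_pairP[tn dn] le] := hab n.
  have -> : chi n = ((ab n).1 - mu1) * ((ab n).2 - mu1) by rewrite /chi tn dn; ring.
  rewrite cmodM => h; rewrite -(@ltr_pXn2r _ 2) ?nnegrE ?cmod_ge0 ?(ltW e0) //.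
  by apply: le_lt_trans h; rewrite expr2; apply: ler_wpM2l => //; exact: cmod_ge0.
split; [by move=> n _; have [] := hab n | exact: a_cvg |].
have -> : (fun n => (ab n).2) = (fun n => \tr (mxRtoC (V_ n)) - (ab n).1).
  by apply/funext => n; have [/eigenvalue_pairP[-> _] _] := hab n; ring.
have -> : mu2 = \tr (mxRtoC V) - mu1 by rewrite tV; ring.
exact: (cvgB cvg_trace_mxRtoC a_cvg).
Qed.

Hypothesis V_aincr : forall i j, summable_increments (fun n => mxRtoC (V_ n) i j).

(** The eigenvalue at time [n] nearly solves the characteristic equation of time
    [n.+1]: the defect is an increment of the trace and of the determinant. The
    other root of this equation stays away, because the limits differ. *)
Lemma summable_increments_eigenvalue (mu1 mu2 : C) (mu1_ mu2_ : nat -> C) :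
  mu1 != mu2 ->
  eigenvalue_labelling V_ mu1 mu2 mu1_ mu2_ -> summable_increments mu1_.
Proof.
move=> mu12 [ev m1 m2].
have at_ : summable_increments (fun n => \tr (mxRtoC (V_ n))).
  apply: abs_summable_near_eq (summable_incrementsD (@V_aincr 0 0) (@V_aincr 1 1)).
  by apply: nearW => n; rewrite !mxtrace2.
have ad : summable_increments (fun n => \det (mxRtoC (V_ n))).
  have h := summable_incrementsM (@V_aincr 0 0) (@V_aincr 1 1) (@cvg_mxRtoC 0 0)
      (@cvg_mxRtoC 1 1).
  have h' := summable_incrementsM (@V_aincr 0 1) (@V_aincr 1 0) (@cvg_mxRtoC 0 1)
      (@cvg_mxRtoC 1 0).
  apply: abs_summable_near_eq (summable_incrementsD h (summable_incrementsN h')).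
  by apply: nearW => n; rewrite !det_mx2.
have gap : (fun n => mu1_ n - mu2_ n.+1) @ \oo --> mu1 - mu2.
  exact: (cvgB m1 (cvg_shift1 m2)).
have gap0 : mu1 - mu2 != 0 by rewrite subr_eq0.
have igap : (fun n => (mu1_ n - mu2_ n.+1)^-1) @ \oo --> (mu1 - mu2)^-1.
  exact: (cvgV gap0 gap).
have := abs_summableM (abs_summableD (abs_summableM at_ m1) (abs_summableN ad))
    igap.
apply: abs_summable_near_eq; have [N _ HN] := cvgr_neq0 _ gap gap0.
exists (maxn N 1) => // n /=; rewrite geq_max => /andP[/HN g0 n1].
have [-> ->] := eigenvalue_pairP (ev n n1).
have [-> ->] := eigenvalue_pairP (ev n.+1 (leqW n1)).
by field.
Qed.

End Labelling.

(** * The asymptotic basis *)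

(** The right-hand side refers to the frame vector [y] of the next time step; the
    defect [x - y] goes into the forcing. *)
Lemma mulmx_perturbed_eigenvector (K : fieldType) (V E : 'M[K]_2) (p mu : K)
    (x y : 'cV[K]_2) :
  V *m x = mu *: x ->
  (1%:M + p *: V + E) *m x = (1 + p * mu) *: y + ((1 + p * mu) *: (x - y) + E *m x).
Proof.
move=> Vx; rewrite !mulmxDl mul1mx -scalemxAl Vx scalerA addrA; congr (_ + _).
by rewrite -scalerDr [y + _]addrC subrK scalerDl scale1r.
Qed.

Lemma scaleB_entry (K : pzRingType) (c : K) (x y : 'cV[K]_2) i :
  (c *: (x - y)) i 0 = c * (x i 0 - y i 0).
Proof. by rewrite !mxE. Qed.

Section Projections.
Variables (R : realType) (W : nat -> 'M[CC R]_2) (Wl : 'M[CC R]_2).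
Variables (m : nat -> CC R) (ml : CC R) (x : 'cV[CC R]_2).
Hypothesis W_cvg : forall i j, (fun n => W n i j) @ \oo --> Wl i j.
Hypothesis m_cvg : m @ \oo --> ml.

Lemma cvg_eigenprojection : cvg_coords (fun n => W n *m x - m n *: x)
    (Wl *m x - ml *: x).
Proof.
move=> i; have -> : (fun n => (W n *m x - m n *: x) i 0) =
    (fun n => W n i 0 * x 0 0 + W n i 1 * x 1 0 - m n * x i 0).
  by apply/funext => n; rewrite -mulmx2_col !mxE.
have -> : (Wl *m x - ml *: x) i 0 = Wl i 0 * x 0 0 + Wl i 1 * x 1 0 - ml * x i 0.
  by rewrite -mulmx2_col !mxE.
exact: (cvgB (cvgD (cvgM (@W_cvg i 0) (cvg_cst (x 0 0)))
  (cvgM (@W_cvg i 1) (cvg_cst (x 1 0))))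
  (cvgM m_cvg (cvg_cst (x i 0)))).
Qed.

Hypothesis W_aincr : forall i j, summable_increments (fun n => W n i j).
Hypothesis m_aincr : summable_increments m.

Lemma summable_increments_eigenprojection i :
  summable_increments (fun n => (W n *m x - m n *: x) i 0).
Proof.
have cst z : (fun=> z) @ \oo --> (z : CC R) by exact: cvg_cst.
have h0 := summable_incrementsM (@W_aincr i 0) (@summable_increments_cst _ (x 0 0))
    (@W_cvg i 0) (cst (x 0 0)).
have h1 := summable_incrementsM (@W_aincr i 1) (@summable_increments_cst _ (x 1 0))
    (@W_cvg i 1) (cst (x 1 0)).
have h2 := summable_incrementsM m_aincr (@summable_increments_cst _ (x i 0)) m_cvg
    (cst (x i 0)).
have := summable_incrementsD (summable_incrementsD h0 h1) (summable_incrementsN h2).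
apply: abs_summable_near_eq; apply: nearW => n.
have E k : (W k *m x - m k *: x) i 0 =
    W k i 0 * x 0 0 + W k i 1 * x 1 0 - m k * x i 0.
  by rewrite -mulmx2_col !mxE.
by rewrite !E.
Qed.

(** The forcing has two sources, the motion of the eigenvector and the matrix
    [E n]. *)
Lemma abs_summable_forcing (al : nat -> CC R) (al_lim : CC R)
    (E : nat -> 'M[CC R]_2)
    (F := fun n => W n *m x - m n *: x) :
  al @ \oo --> al_lim -> (forall i j, abs_summable (fun n => E n i j)) ->
  abs_summable_coords (fun n => al n *: (F n - F n.+1) + E n *m F n).
Proof.
move=> alc aE i; have Fc := @cvg_eigenprojection.
have h := abs_summableM (abs_summableN (@summable_increments_eigenprojection i))
    alc.
have h' := abs_summableD (abs_summableM (@aE i 0) (@Fc 0))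
    (abs_summableM (@aE i 1) (@Fc 1)).
apply: abs_summable_near_eq (abs_summableD h h'); apply: nearW => n.
by rewrite mxE scaleB_entry mulmx2_col opprB [X in _ = X + _]mulrC.
Qed.

End Projections.

(** Up to nonzero scalars the two solutions tend to [x1] and [x2], so they are
    independent at some late time. *)
Lemma asymptotics_basis (R : realType) (A : nat -> 'M[CC R]_2)
    (u1 u2 : nat -> 'cV[CC R]_2) (c1 c2 : nat -> CC R) (x1 x2 : 'cV[CC R]_2) :
  (forall n, (1 <= n)%N -> \det (A n) != 0) ->
  solution A u1 -> solution A u2 ->
  asymptotics u1 (nzprod c1) x1 -> asymptotics u2 (nzprod c2) x2 ->
  cross x1 x2 != 0 -> solution_basis A u1 u2.
Proof.
move=> A_inv s1 s2 [e1 [e10 u1E]] [e2 [e20 u2E]] x12.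
have xe (e : nat -> 'cV[CC R]_2) x : e @ \oo --> (0 : 'cV[CC R]_2) ->
    cvg_coords (fun n => x + e n) x.
  move=> e0 i; have h := cvg_entry (i := i) (j := 0) e0.
  have -> : (fun n => (x + e n) i 0) = (fun n => x i 0 + e n i 0).
    by apply/funext => n; rewrite mxE.
  rewrite mxE in h; rewrite -[X in _ --> X]addr0; exact: (cvgD (cvg_cst (x i 0)) h).
have [N _ HN] := cvgr_neq0 _ (cvg_cross (xe _ x1 e10) (xe _ x2 e20)) x12.
have N1 : (1 <= maxn N 1)%N by exact: leq_maxr.
apply: (@solution_basis_of_cross _ _ A_inv _ _ (maxn N 1)) => //.
rewrite u1E // u2E // crossZZ !mulf_neq0 ?nzprod_neq0 //.
by apply: HN; exact: leq_maxl.
Qed.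

Theorem theorem2 (R : realType) (p : nat -> R) (R_ : nat -> 'M[CC R]_2)
    (V_ : nat -> 'M[R]_2) (V : 'M[R]_2)
    (p_gt0 : forall n, (1 <= n)%N -> 0 < p n)
    (p_cvg0 : p @ \oo --> (0 : R))
    (p_sum : (\sum_(1 <= n <oo) (p n)%:E = +oo)%E)
    (R_sum : (\sum_(1 <= n <oo) (mxnormC (R_ n))%:E < +oo)%E)
    (V_sum : (\sum_(1 <= n <oo) (`|V_ n.+1 - V_ n|%R)%:E < +oo)%E)
    (V_cvg : V_ @ \oo --> V)
    (V_discr : discr V != 0)
    (A := fun n : nat => 1%:M + RtoC (p n) *: mxRtoC (V_ n) + R_ n)
    (A_inv : forall n, (1 <= n)%N -> \det (A n) != 0)
    (mu1 mu2 : CC R)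
    (mu_eig : eigenvalue_pair (mxRtoC V) mu1 mu2)
    (mu_le : complex.Re mu1 <= complex.Re mu2)
    (x1 x2 : 'cV[CC R]_2)
    (x1_eig : eigenvector (mxRtoC V) mu1 x1)
    (x2_eig : eigenvector (mxRtoC V) mu2 x2) :
  (exists mu1_ mu2_ : nat -> CC R,
     eigenvalue_labelling V_ mu1 mu2 mu1_ mu2_) /\
  (forall mu1_ mu2_ : nat -> CC R,
     eigenvalue_labelling V_ mu1 mu2 mu1_ mu2_ ->
     exists u1 u2 : nat -> 'cV[CC R]_2,
       [/\ solution_basis A u1 u2,
           asymptotics u1 (nzprod (fun k => 1 + RtoC (p k) * mu1_ k)) x1
         & asymptotics u2 (nzprod (fun k => 1 + RtoC (p k) * mu2_ k)) x2]).
Proof.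
split; first exact: (eigenvalue_labelling_exists V_cvg mu_eig).
move=> mu1_ mu2_ lab; have [ev m1 m2] := lab.
have lab' : eigenvalue_labelling V_ mu2 mu1 mu2_ mu1_.
  split; [|exact: m2|exact: m1].
  by move=> n n1; apply: eigenvalue_pairC; exact: ev.
have mu12 : mu1 != mu2.
  apply: contra V_discr => /eqP e; have [_ h] := eigenvalues_RtoC mu_eig.
  by rewrite -(inj_eq (@RtoC_inj R)) -h e subrr expr0n rmorph0.
have mu21 : mu2 != mu1 by rewrite eq_sym.
have x12 := cross_eigenvectors mu12 x1_eig x2_eig.
have x21 := cross_eigenvectors mu21 x2_eig x1_eig.
have aR i j : abs_summable (fun n => R_ n i j).
  apply: (@series_cvg_near _ _ (fun n => mxnormC (R_ n)) 1).
  - by move=> n; exact: cmod_ge0.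
  - move=> n; have := normr_ge0 (R_ n); rewrite lecE => /andP[_]; exact.
  - apply: nearW => n; rewrite mul1r; have := ler_entry_norm (R_ n) i j.
    by rewrite lecE => /andP[_]; exact.
  apply: summable_from1 R_sum => n.
  by have := normr_ge0 (R_ n); rewrite lecE => /andP[_]; exact.
have aV i j : summable_increments (fun n => mxRtoC (V_ n) i j).
  apply: (@series_cvg_near _ _ (fun n => `|V_ n.+1 - V_ n|) 1) => [n|n||].
  - exact: cmod_ge0.
  - exact: normr_ge0.
  - apply: nearW => n; rewrite mul1r !mxE -rmorphB cmod_RtoC.
    by have := ler_entry_norm (V_ n.+1 - V_ n) i j; rewrite !mxE.
  by apply: summable_from1 V_sum => n; exact: normr_ge0.
have am1 := summable_increments_eigenvalue V_cvg aV mu12 lab.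
have am2 := summable_increments_eigenvalue V_cvg aV mu21 lab'.
pose al n := 1 + RtoC (p n) * mu1_ n; pose be n := 1 + RtoC (p n) * mu2_ n.
have pC : (fun n => RtoC (p n)) @ \oo --> (0 : CC R).
  by rewrite -(rmorph0 (@RtoC R)); exact: cvg_RtoC.
have to1 (m : nat -> CC R) (ml : CC R) : m @ \oo --> ml ->
    (fun n => 1 + RtoC (p n) * m n) @ \oo --> (1 : CC R).
  move=> mc; rewrite -[X in _ --> X]addr0 -(mul0r ml).
  exact: (cvgD (cvg_cst (1 : CC R)) (cvgM pC mc)).
have al1 : al @ \oo --> (1 : CC R) := to1 _ _ m1.
have be1 : be @ \oo --> (1 : CC R) := to1 _ _ m2.
have VC := @cvg_mxRtoC _ _ _ V_cvg.
pose F n := mxRtoC (V_ n) *m x1 - mu2_ n *: x1.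
pose G n := mxRtoC (V_ n) *m x2 - mu1_ n *: x2.
have Fv : cvg_coords F ((mu1 - mu2) *: x1).
  by rewrite scalerBl -(proj2 x1_eig); exact: cvg_eigenprojection.
have Gw : cvg_coords G ((mu2 - mu1) *: x2).
  by rewrite scalerBl -(proj2 x2_eig); exact: cvg_eigenprojection.
have k0 : mu1 - mu2 != 0 by rewrite subr_eq0.
have l0 : mu2 - mu1 != 0 by rewrite subr_eq0.
pose f n := al n *: (F n - F n.+1) + R_ n *m F n.
pose g n := be n *: (G n - G n.+1) + R_ n *m G n.
have af : abs_summable_coords f by exact: (abs_summable_forcing (x := x1) VC m2 aV
    am2 al1 aR).
have ag : abs_summable_coords g by exact: (abs_summable_forcing (x := x2) VC m1 aV
    am1 be1 aR).
have AF n : (1 <= n)%N -> A n *m F n = al n *: F n.+1 + f n.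
  move=> n1; apply: mulmx_perturbed_eigenvector; apply: eigenprojection; exact: ev.
have AG n : (1 <= n)%N -> A n *m G n = be n *: G n.+1 + g n.
  move=> n1; apply: mulmx_perturbed_eigenvector; apply: eigenprojection.
  by apply: eigenvalue_pairC; exact: ev.
suff [[u1 [s1 a1]] [u2 [s2 a2]]] :
    (exists u, solution A u /\ asymptotics u (nzprod al) x1) /\
    (exists u, solution A u /\ asymptotics u (nzprod be) x2).
  exists u1, u2; split; [|exact: a1|exact: a2].
  exact: (asymptotics_basis A_inv s1 s2 a1 a2).
have sub := subdominant_vector A_inv al1 be1 Fv k0 Gw l0 x12 af ag AF AG.
have sub' := subdominant_vector A_inv be1 al1 Gw l0 Fv k0 x21 ag af AG AF.
have dom := dominant_vector A_inv al1 be1 Fv k0 Gw l0 x12 af ag AF AG.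
have dc := cvg_discr V_cvg.
have /orP[d0|d0] : (discr V < 0) || (0 < discr V) by rewrite -neq_lt.
  (* Negative discriminant: the eigenvalues of [V_ n] are conjugate and [p n] is
     real, so neither diagonal entry dominates. *)
  have near_eq : \forall n \near \oo, cmod (al n) = cmod (be n).
    have [N _ HN] := cvgr_lt _ dc _ d0.
    exists (maxn N 1) => // n /=; rewrite geq_max => /andP[/HN dn n1].
    have [hr hi] := eigenvalues_conj (ev n n1) dn; exact: cmod_eq_conj.
  split; [apply: sub|apply: sub']; move: near_eq; apply: filterS => n -> //.
(* Positive discriminant: the eigenvalues are real, and eventually
   [be n - al n] is at least [p n * gap], while [be n <= 2]. *)
have [im1 im2] := eigenvalues_real mu_eig d0.
have lt12 : complex.Re mu1 < complex.Re mu2.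
  rewrite lt_neqAle mu_le andbT; apply: contra mu12 => /eqP h.
  by apply/eqP/eqP; rewrite eq_complex h im1 im2 !eqxx.
pose gap := (complex.Re mu2 - complex.Re mu1) / 2.
have gap0 : 0 < gap by rewrite divr_gt0 // subr_gt0.
have gap2 : 0 < gap / 2 by rewrite divr_gt0.
have gap_near : \forall n \near \oo,
    gap < complex.Re (mu2_ n) - complex.Re (mu1_ n).
  apply: (cvgr_gt (complex.Re mu2 - complex.Re mu1));
    first exact: (cvgB (cvg_Re m2) (cvg_Re m1)).
  by rewrite /gap ltr_pdivrMr //; lra.
have near_le : \forall n \near \oo,
    cmod (al n) <= (1 - `|p n| * (gap / 2)) * cmod (be n).
  have [N1 _ H1] := gap_near.
  have [N2 _ H2] := cvgr_gt _ dc _ d0.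
  have [N3 _ H3] := proj1 (@cvgrPdist_lt _ _ _ _ _ _ _) (cvg_Re al1) 1 ltr01.
  have [N4 _ H4] := proj1 (@cvgrPdist_lt _ _ _ _ _ _ _) (cvg_Re be1) 1 ltr01.
  exists (maxn (maxn (maxn N1 N2) (maxn N3 N4)) 1) => // n /=.
  rewrite !geq_max -!andbA => /and5P[/H1 h1 /H2 h2 /H3 h3 /H4 h4 n1].
  have [i1 i2] := eigenvalues_real (ev n n1) h2.
  have pn := p_gt0 n n1; rewrite (gtr0_norm pn).
  have reE (z : CC R) : complex.Im z = 0 ->
      1 + RtoC (p n) * z = RtoC (1 + p n * complex.Re z).
    by case: z => a b /= ->; apply/eqP; rewrite eq_complex /=; apply/andP; split;
      apply/eqP; ring.
  move: h3 h4; rewrite /al /be !reE //= !cmod_RtoC !ltr_distl =>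
    /andP[a0 a2] /andP[b0 b2].
  have al_ge0 : 0 <= 1 + p n * complex.Re (mu1_ n) by lra.
  have be_ge0 : 0 <= 1 + p n * complex.Re (mu2_ n) by lra.
  have be_le2 : 1 + p n * complex.Re (mu2_ n) <= 2 by lra.
  rewrite (ger0_norm al_ge0) (ger0_norm be_ge0).
  have h5 := ler_wpM2l (ltW pn) (ltW h1).
  have h6 := ler_wpM2l (mulr_ge0 (ltW pn) (ltW gap2)) be_le2.
  lra.
split.
  apply: sub; move: near_le; apply: filterS => n h; apply: le_trans h _.
  rewrite -[leRHS]mul1r; apply: ler_wpM2r; first exact: cmod_ge0.
  by rewrite gerBl mulr_ge0 // ltW.
apply: (dom (fun n => `|p n| * (gap / 2))) near_le => [n|N M].
  by rewrite mulr_ge0 // ltW.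
(* The value [p 0] may be negative, hence the absolute value. *)
pose h n := `|p n| * (gap / 2).
have h0 n : 0 <= h n by rewrite mulr_ge0 // ltW.
have [n Hn] := diverges_from1 (fun n n1 => ltW (p_gt0 n n1)) p_sum
    ((M + series h N) / (gap / 2)).
exists n; rewrite (series_shift h) lerBrDr.
rewrite ler_pdivrMr // in Hn; apply: le_trans Hn _.
apply: (@le_trans _ _ (series h n)); last first.
  by apply: (@nondecreasing_series _ h xpredT) => //; exact: leq_addl.
rewrite mulr_suml; case: n => [|n]; first by rewrite !big_geq // /series /= big_geq.
rewrite /series /= [leRHS]big_ltn // -[leLHS]add0r; apply: lerD => //.
by apply: ler_sum => k _; apply: ler_wpM2r; rewrite ?ler_norm // ltW.
Qed.
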